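(* Partially order the ring of symmetric functions by $f\le g$ iff $g-f$ is a nonnegative linear combination of the $h_\lambda$. Then for all $n,j,k$: (1) $Q_{n,j,k}$ and $Q_{n,j}$ are $h$-positive symmetric functions; (2) the polynomial $\sum_{j=0}^{n-1}Q_{n,j,k}t^j$ is $t$-symmetric and $t$-unimodal with center of symmetry $\frac{n-k}2$; (3) the polynomial $\sum_{j=0}^{n-1}Q_{n,j}t^j$ is $t$-symmetric and $t$-unimodal with center of symmetry $\frac{n-1}2$.
   Context: $h_\lambda=h_{\lambda_1}\cdots h_{\lambda_\ell}$ for a partition $\lambda$, $h_m$ complete homogeneous symmetric functions; $h$-positive means a nonnegative linear combination of the $h_\lambda$. A nonzero polynomial $f(t)=f_rt^r+f_{r+1}t^{r+1}+\dots+f_st^s$ with coefficients in a partially ordered ring ($f_r,f_s\neq0$) is $t$-symmetric with center of symmetry $\frac{r+s}2$ if $f_{r+i}=f_{s-i}$ for $0\le i\le s-r$, and $t$-unimodal if $f_r\le f_{r+1}\le\dots\le f_{\lfloor (r+s)/2\rfloor}=f_{\lfloor(r+s+1)/2\rfloor}\ge\dots\ge f_{s-1}\ge f_s$. For $\sigma\in\mathfrak S_n$ in one-line notation, $\mathrm{Exc}(\sigma)=\{i\in[n-1]:\sigma_i>i\}$, $\mathrm{exc}=|\mathrm{Exc}|$, $\mathrm{fix}$ the number of fixed points. Order $\bar1<\dots<\bar n<1<\dots<n$; $\bar\sigma$ is $\sigma$ with $\sigma_i$ barred for $i\in\mathrm{Exc}(\sigma)$; $\mathrm{Exd}(\sigma)=\{i\in[n-1]:\bar\sigma_i>\bar\sigma_{i+1}\}$.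 $F_{S,n}=\sum x_{i_1}\cdots x_{i_n}$ over $i_1\ge\dots\ge i_n\ge1$ with $i_j>i_{j+1}$ for $j\in S$. $Q_{n,j,k}=\sum F_{\mathrm{Exd}(\sigma),n}$ over $\sigma\in\mathfrak S_n$ with $\mathrm{exc}=j$, $\mathrm{fix}=k$, and $Q_{n,j}=\sum_kQ_{n,j,k}$. *)

(* Defs.v *)
From HB Require Import structures.
From mathcomp Require Import all_boot all_order all_fingroup all_algebra.
From mathcomp Require Import finmap multiset boolp.

Set Implicit Arguments.
Unset Strict Implicit.
Unset Printing Implicit Defensive.

Import Order.TTheory GRing.Theory Num.Theory.

Local Open Scope fset_scope.
Local Open Scope mset_scope.
Local Open Scope ring_scope.

(* A monomial in the countably many variables x_0, x_1, x_2, ... is the finite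
   multiset of the indices of its variables, so that the product of monomials
   is the multiset sum msetD.  (The variables are numbered from 0 instead of
   from 1.) *)
Notation monomial := {mset nat}.

Section Divisors.

Definition divisors_mon (u : monomial) : seq monomial :=
  undup [seq seq_mset (mask m (u : seq nat))
        | m : (size (u : seq nat)).-tuple bool].

Lemma divisors_mon_uniq u : uniq (divisors_mon u).
Proof. exact: undup_uniq. Qed.

Lemma mem_divisors_mon (a u : monomial) :
  (a \in divisors_mon u) = (msubset a u).
Proof.
rewrite mem_undup; apply/imageP/idP => [[m _ ->]|le_au].
  apply/msubsetP => x; rewrite mset_seqE -count_mem_mset.
  exact/leq_count_subseq/mask_subseq.
have /count_subseqP[s /subseqP[m sz_m ->] ps] :
    forall x, (count_mem x (a : seq nat) <= count_mem x (u : seq nat))%N.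
  by move=> x; rewrite !count_mem_mset; move/msubsetP: le_au.
have sz : size m == size (u : seq nat) by apply/eqP.
exists (Tuple sz) => //=.
by rewrite -[LHS]seq_mset_id; apply/eq_seq_msetP.
Qed.

End Divisors.

(* R[[x_0, x_1, x_2, ...]], as the coefficient functions on monomials. *)
Record fps (R : Type) := Fps { coefm : monomial -> R }.

HB.instance Definition _ (R : Type) := gen_eqMixin (fps R).
HB.instance Definition _ (R : Type) := gen_choiceMixin (fps R).

Lemma fpsP (R : Type) (f g : fps R) : coefm f =1 coefm g -> f = g.
Proof. by case: f g => [f] [g] /= /funext ->. Qed.

Section Zmodule.
Variable R : zmodType.
Implicit Types f g h : fps R.

Definition fps_zero : fps R := Fps (fun _ => 0).
Definition fps_opp f : fps R := Fps (fun u => - coefm f u).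
Definition fps_add f g : fps R := Fps (fun u => coefm f u + coefm g u).

Lemma fps_addA : associative fps_add.
Proof. by move=> f g h; apply: fpsP => u /=; rewrite addrA. Qed.
Lemma fps_addC : commutative fps_add.
Proof. by move=> f g; apply: fpsP => u /=; rewrite addrC. Qed.
Lemma fps_add0 : left_id fps_zero fps_add.
Proof. by move=> f; apply: fpsP => u /=; rewrite add0r. Qed.
Lemma fps_addN : left_inverse fps_zero fps_opp fps_add.
Proof. by move=> f; apply: fpsP => u /=; rewrite addNr. Qed.

HB.instance Definition _ :=
  GRing.isZmodule.Build (fps R) fps_addA fps_addC fps_add0 fps_addN.

Lemma coefm0 u : coefm (0 : fps R) u = 0. Proof. by []. Qed.
Lemma coefmD f g u : coefm (f + g) u = coefm f u + coefm g u.
Proof. by []. Qed.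
Lemma coefmN f u : coefm (- f) u = - coefm f u. Proof. by []. Qed.
Lemma coefm_sum I (r : seq I) (P : pred I) (F : I -> fps R) u :
  coefm (\sum_(i <- r | P i) F i) u = \sum_(i <- r | P i) coefm (F i) u.
Proof. exact: (big_morph (fun f => coefm f u)). Qed.

End Zmodule.

Section Ring.
Variable R : comNzRingType.
Implicit Types (f g h : fps R) (S : seq monomial).

Definition fps_one : fps R := Fps (fun u => (u == mset0)%:R).

Definition fps_mul f g : fps R := Fps (fun u =>
  \sum_(a <- divisors_mon u) \sum_(b <- divisors_mon u | msetD a b == u)
     coefm f a * coefm g b).

Lemma sum_divisors_mon S u (F : monomial -> R) : uniq S ->
  {subset divisors_mon u <= S} -> (forall a, ~~ msubset a u -> F a = 0) ->
  \sum_(a <- divisors_mon u) F a = \sum_(a <- S) F a.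
Proof.
move=> uS sS F0.
rewrite [RHS](bigID (mem (divisors_mon u))) /= [X in _ + X]big1 ?addr0; last first.
  by move=> a; rewrite mem_divisors_mon => /F0.
rewrite -[RHS]big_filter; apply: perm_big; apply: uniq_perm.
- exact: divisors_mon_uniq.
- exact: filter_uniq.
by move=> a; rewrite mem_filter /=; case: (boolP (a \in divisors_mon u)) => // /sS.
Qed.

Lemma coefmM_sub S f g u : uniq S -> {subset divisors_mon u <= S} ->
  coefm (fps_mul f g) u =
  \sum_(a <- S) \sum_(b <- S | msetD a b == u) coefm f a * coefm g b.
Proof.
move=> uS sS /=.
have subl a b : msetD a b = u -> msubset a u.
  by move=> <-; apply/msubsetP => x; rewrite msetE2 leq_addr.
have subr a b : msetD a b = u -> msubset b u.
  by rewrite msetDC; apply: subl.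
rewrite (sum_divisors_mon uS sS); last first.
  move=> a /negP na; apply: big1 => b /eqP/subl; by [].
apply: eq_bigr => a _; rewrite big_mkcond [RHS]big_mkcond /=.
apply: sum_divisors_mon => // b /negP nb.
by case: eqP => // /subr.
Qed.

Lemma divisors_mon_trans a u :
  msubset a u -> {subset divisors_mon a <= divisors_mon u}.
Proof.
by move=> au b; rewrite !mem_divisors_mon => /msubset_trans; apply.
Qed.

Lemma fps_mulC : commutative fps_mul.
Proof.
move=> f g; apply: fpsP => u /=.
rewrite (exchange_big_dep predT) //=.
apply: eq_bigr => a _; apply: eq_big => [b|b _]; first by rewrite msetDC.
exact: mulrC.
Qed.

Lemma fps_mulDl : left_distributive fps_mul +%R.
Proof.
move=> f g h; apply: fpsP => u /=; rewrite -big_split /=.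
apply: eq_bigr => a _; rewrite -big_split /=.
by apply: eq_bigr => b _; rewrite mulrDl.
Qed.

Lemma fps_mul1 : left_id fps_one fps_mul.
Proof.
move=> f; apply: fpsP => u /=.
rewrite (bigD1_seq mset0) ?divisors_mon_uniq ?mem_divisors_mon ?msub0set //=.
rewrite [X in _ + X]big1 ?addr0; last first.
  by move=> a /negbTE ->; apply: big1 => b _; rewrite mul0r.
rewrite (eq_bigl (pred1 u)) => [|b]; last by rewrite /= mset0D.
rewrite eqxx -big_filter filter_pred1_uniq ?divisors_mon_uniq //.
  by rewrite big_seq1 mul1r.
by rewrite mem_divisors_mon msubset_refl.
Qed.

Lemma fps_mulA : associative fps_mul.
Proof.
have trip f g h u : coefm (fps_mul (fps_mul f g) h) u =
    \sum_(a <- divisors_mon u) \sum_(b <- divisors_mon u)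
    \sum_(c <- divisors_mon u) (if msetD (msetD a b) c == u
      then coefm f a * coefm g b * coefm h c else 0).
  set S := divisors_mon u; rewrite (@coefmM_sub S) ?divisors_mon_uniq //.
  transitivity (\sum_(d <- S) \sum_(c <- S | msetD d c == u)
      \sum_(a <- S) \sum_(b <- S | msetD a b == d)
        coefm f a * coefm g b * coefm h c).
    rewrite big_seq [RHS]big_seq; apply: eq_bigr => d.
    rewrite mem_divisors_mon => du; apply: eq_bigr => c _.
    rewrite (coefmM_sub f g (divisors_mon_uniq u) (divisors_mon_trans du)).
    by rewrite mulr_suml; apply: eq_bigr => a _; rewrite mulr_suml.
  under eq_bigr => d _ do rewrite exchange_big.
  rewrite exchange_big; apply: eq_bigr => a _ /=.
  under eq_bigr => d _ do
    [under eq_bigr => c _ do rewrite big_mkcond; rewrite exchange_big /=].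
  rewrite exchange_big; apply: eq_bigr => b _ /=.
  under eq_bigr => d _ do rewrite big_mkcond.
  rewrite exchange_big /=.
  apply: eq_bigr => c _.
  have [ab|nab] := boolP (msetD a b \in S).
    rewrite (bigD1_seq (msetD a b)) ?divisors_mon_uniq //= eqxx big1 ?addr0 //.
    by move=> d nd; rewrite [_ == d]eq_sym (negbTE nd); case: ifP.
  rewrite big1_seq; last first.
    move=> d /= dS; case: (msetD a b =P d) dS => [<-|_ _]; last by case: ifP.
    by rewrite (negbTE nab).
  case: eqP => // e; case/negP: nab; rewrite mem_divisors_mon -e.
  by apply/msubsetP => x; rewrite !msetE2 leq_addr.
move=> f g h; rewrite fps_mulC; apply: fpsP => u; rewrite !trip.
under eq_bigr => a _ do rewrite exchange_big /=.
rewrite exchange_big /=; apply: eq_bigr => a _; apply: eq_bigr => b _.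
apply: eq_bigr => c _; rewrite (msetDC _ a) msetDA.
by case: ifP => // _; rewrite [LHS]mulrC mulrA.
Qed.

Lemma fps_one_neq0 : fps_one != 0.
Proof.
apply/eqP => /(congr1 (fun f => coefm f mset0)) /= /eqP.
by rewrite eqxx oner_eq0.
Qed.

HB.instance Definition _ := GRing.Zmodule_isComNzRing.Build (fps R)
  fps_mulA fps_mulC fps_mul1 fps_mulDl fps_one_neq0.

Definition fps_scale (c : R) f : fps R := Fps (fun u => c * coefm f u).

Lemma fps_scaleA a b f : fps_scale a (fps_scale b f) = fps_scale (a * b) f.
Proof. by apply: fpsP => u /=; rewrite mulrA. Qed.
Lemma fps_scale1 : left_id 1 fps_scale.
Proof. by move=> f; apply: fpsP => u /=; rewrite mul1r. Qed.
Lemma fps_scaleDr : right_distributive fps_scale +%R.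
Proof. by move=> c f g; apply: fpsP => u /=; rewrite mulrDr. Qed.
Lemma fps_scaleDl f : {morph fps_scale^~ f : a b / a + b}.
Proof. by move=> a b; apply: fpsP => u /=; rewrite mulrDl. Qed.

HB.instance Definition _ := GRing.Zmodule_isLmodule.Build R (fps R)
  fps_scaleA fps_scale1 fps_scaleDr fps_scaleDl.

Lemma fps_scaleAl c f g : c *: (f * g) = c *: f * g.
Proof.
apply: fpsP => u /=; rewrite mulr_sumr; apply: eq_bigr => a _.
by rewrite mulr_sumr; apply: eq_bigr => b _; rewrite mulrA.
Qed.

HB.instance Definition _ := GRing.Lmodule_isLalgebra.Build R (fps R)
  fps_scaleAl.
HB.instance Definition _ := GRing.Lalgebra_isComAlgebra.Build R (fps R).

Lemma coefm1 u : coefm (1 : fps R) u = (u == mset0)%:R. Proof. by []. Qed.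
Lemma coefmM f g u : coefm (f * g) u =
  \sum_(a <- divisors_mon u) \sum_(b <- divisors_mon u | msetD a b == u)
     coefm f a * coefm g b.
Proof. by []. Qed.
Lemma coefmZ c f u : coefm (c *: f) u = c * coefm f u. Proof. by []. Qed.

End Ring.

Section SymmetricFunctions.
Variable R : numDomainType.
Implicit Types f g : fps R.

Definition symmetric_function f : Prop :=
  (exists d : nat, forall u : monomial, coefm f u != 0 -> (size u <= d)%N) /\
  (forall s : nat -> nat, bijective s ->
     forall u : monomial, coefm f (seq_mset [seq s i | i <- u]) = coefm f u).

(* h_m is the sum of all monomials of degree m. *)
Definition hsym (m : nat) : fps R := Fps (fun u => (size u == m)%:R).

Definition is_partition (la : seq nat) : bool :=
  sorted geq la && (0%N \notin la).

Definition hsym_part (la : seq nat) : fps R := \prod_(m <- la) hsym m.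

Definition h_positive f : Prop :=
  exists (L : seq (seq nat)) (c : seq nat -> R),
    {in L, forall la, is_partition la && (0 <= c la)} /\
    f = \sum_(la <- L) c la *: hsym_part la.

Definition h_le f g : Prop := h_positive (g - f).

End SymmetricFunctions.

Section SymmetricUnimodal.
Variables (A : nzRingType) (le : A -> A -> Prop).
Implicit Type f : {poly A}.

(* r and s in f = f_r t^r + ... + f_s t^s with f_r, f_s nonzero *)
Definition low_deg f : nat := find (predC1 0) (f : seq A).
Definition high_deg f : nat := (size f).-1.

Definition center_of_symmetry f : rat := ((low_deg f + high_deg f)%:R / 2%:R).

Definition t_symmetric f : Prop :=
  let r := low_deg f in let s := high_deg f in
  f != 0 /\ forall i : nat, (i <= s - r)%N -> f`_(r + i) = f`_(s - i).

Definition t_unimodal f : Prop :=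
  let r := low_deg f in let s := high_deg f in
  let lo := ((r + s)./2)%N in let hi := ((r + s).+1./2)%N in
  [/\ f != 0,
      forall i : nat, (r <= i < lo)%N -> le f`_i f`_i.+1,
      f`_lo = f`_hi &
      forall i : nat, (hi <= i < s)%N -> le f`_i.+1 f`_i].

End SymmetricUnimodal.

(* Permutations act on 'I_n = {0, ..., n-1}; the ordinal i stands for the
   position or value i + 1 of [n]. *)
Section EulerianQuasisymmetric.
Variable n : nat.
Implicit Types (s : 'S_n) (i : 'I_n).

Definition Exc s : {set 'I_n} := [set i : 'I_n | (i < s i)%N].
Definition exc s : nat := #|Exc s|.
Definition fixpts s : nat := #|[set i : 'I_n | s i == i]|.

(* The i-th letter of the barred word, under the order embedding of the
   alphabet \bar 1 < ... < \bar n < 1 < ... < n into nat that sends the barred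
   letters to 0, ..., n-1 and the unbarred ones to n, ..., 2n-1. *)
Definition barred s i : nat := if i \in Exc s then (s i : nat) else (n + s i)%N.

Definition Exd s : {set 'I_n} :=
  [set i : 'I_n | [exists j : 'I_n, (j == i.+1 :> nat) && (barred s j < barred s i)%N]].

(* The words i_1, ..., i_n indexing the sum that defines F_{S,n}; the element
   n - 1 of 'I_n, which is not a position of [n-1], is irrelevant in S. *)
Definition F_word (S : {set 'I_n}) (w : seq nat) : bool :=
  (size w == n) &&
  [forall j : 'I_n, (j.+1 < n)%N ==>
     (nth 0%N w j.+1 <= nth 0%N w j)%N &&
     ((j \in S) ==> (nth 0%N w j.+1 < nth 0%N w j)%N)].

(* The coefficient of a monomial u in F_{S,n} is the number of such words among
   the words w whose monomial is u, i.e. the rearrangements of u. *)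
Definition F_fun (R : numDomainType) (S : {set 'I_n}) : fps R :=
  Fps (fun u => (count (F_word S) (permutations u))%:R).

End EulerianQuasisymmetric.

Definition Q_njk (R : numDomainType) (n j k : nat) : fps R :=
  \sum_(s : 'S_n | (exc s == j) && (fixpts s == k)) F_fun R (Exd s).

(* A permutation of [n] has at most n fixed points. *)
Definition Q_nj (R : numDomainType) (n j : nat) : fps R :=
  \sum_(k < n.+1) Q_njk R n j k.

(* Main.v *)
Require Import Defs.
From mathcomp Require Import all_boot all_order all_fingroup all_algebra.
From mathcomp Require Import finmap multiset boolp.
From mathcomp Require Import zify ring.

(** Fix a monomial u and let w be its weakly decreasing word.  The coefficient
   of u in Q_{n,j,k} counts the permutations whose barred word increases along
   each block of equal letters of w.  Such a permutation s is recovered from the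
   word v |-> (w(s^-1 v), [s^-1 v < v]), and the words that occur are described
   by conditions on single positions.  So the t^exc-weighted number of these
   permutations is the coefficient of u in a product over the blocks of w of
   polynomials in the linear forms
     T_b = sum_{l < b} x_l + (1 + t) x_b + t sum_{l > b} x_l.
   Since prod_b (T_b - x_b) = t prod_b (T_b - t x_b) over the letters of u, the
   generating function Q of the derangements satisfies
     sum_m (t^m - t) h_m Q = 1 - t,
   that is Q = 1 + sum_m t[m-1]_t h_m Q.  Fixed points contribute a factor h_k,
   and sum_{n,j} Q_{n,j} t^j = 1 + sum_m [m]_t h_m Q.  Multiplication by [m]_t
   and by t preserves h-positivity, symmetry and unimodality. *)

Set Implicit Arguments.
Unset Strict Implicit.
Unset Printing Implicit Defensive.

Import Order.TTheory GRing.Theory Num.Theory.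
Local Open Scope mset_scope.
Local Open Scope ring_scope.

(** * Monomials and power series *)

Section Monomials.
Implicit Types (a b u v : monomial).

Lemma msubDl a b : a `<=` a `+` b.
Proof. by apply/msubsetP => x; rewrite msetE2 leq_addr. Qed.

Lemma size_msetD a b : size (a `+` b) = (size a + size b)%N.
Proof.
have : perm_eq (a `+` b) (a ++ b).
  by apply/allP => x _ /=; rewrite count_cat !count_mem_mset msetE2.
by move/perm_size; rewrite size_cat.
Qed.

Lemma size_mset1 l : size ([mset l] : monomial) = 1%N.
Proof. by rewrite enum_msetn. Qed.

Lemma size_msetB a u : a `<=` u -> size (u `\` a) = (size u - size a)%N.
Proof. by move=> /msetBDKC e; rewrite -[in RHS]e size_msetD addKn. Qed.

Lemma size_msub a u : a `<=` u -> (size a <= size u)%N.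
Proof. by move=> /msetBDKC e; rewrite -e size_msetD leq_addr. Qed.

Lemma msetD_eqB a b u : a `<=` u -> (a `+` b == u) = (b == u `\` a).
Proof.
move=> au; apply/eqP/eqP => [<-|->]; last exact: msetBDKC.
by rewrite msetDKB.
Qed.

End Monomials.

Section Series.
Variable A : comNzRingType.
Implicit Types (f g : fps A) (a b u v : monomial).

Lemma coefmM_div f g u :
  coefm (f * g) u = \sum_(a <- divisors_mon u) coefm f a * coefm g (u `\` a).
Proof.
rewrite coefmM; apply: eq_big_seq => a; rewrite mem_divisors_mon => au.
rewrite (eq_bigl (pred1 (u `\` a))) => [|b]; last by rewrite msetD_eqB.
rewrite -big_filter filter_pred1_uniq ?divisors_mon_uniq ?big_seq1 //.
by rewrite mem_divisors_mon msubsetDl.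
Qed.

Definition mono a : fps A := Fps (fun u => (u == a)%:R).

Lemma coefm_monoM a f u :
  coefm (mono a * f) u = if a `<=` u then coefm f (u `\` a) else 0.
Proof.
rewrite coefmM_div; case: ifP => au.
  rewrite (bigD1_seq a) ?divisors_mon_uniq ?mem_divisors_mon //= eqxx mul1r.
  by rewrite big1 ?addr0 // => b /negbTE ->; rewrite mul0r.
rewrite big_seq big1 // => b; rewrite mem_divisors_mon /=.
by case: eqP => [->|_ _]; rewrite ?au ?mul0r.
Qed.

Lemma mono0 : mono mset0 = 1. Proof. by []. Qed.

Lemma monoM a b : mono a * mono b = mono (a `+` b).
Proof.
apply: fpsP => u; rewrite coefm_monoM /=.
case: ifP => [au|nau]; first by rewrite [_ == b]eq_sym -msetD_eqB // eq_sym.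
by case: eqP => // e; rewrite e msubDl in nau.
Qed.

Lemma mono_prod (I : Type) (r : seq I) (P : pred I) (F : I -> nat) :
  \prod_(i <- r | P i) mono [mset (F i)] = mono (seq_mset [seq F i | i <- r & P i]).
Proof.
elim: r => [|i r IH] /=.
  rewrite big_nil -mono0; congr mono.
  by apply/msetP => x; rewrite mset_seqE mset0E.
rewrite big_cons IH {IH}; case: (P i) => //=.
by rewrite monoM mset_cons.
Qed.

(* Congruence modulo the monomials that do not divide u: it is compatible with
   the ring operations and all that matters for the coefficient of u. *)
Definition agree u f g := forall m, m `<=` u -> coefm f m = coefm g m.

(** The coefficient of a product at a divisor of u only involves coefficients of the factors at
    divisors of that divisor. *)
Lemma agreeM u f f' g g' :
  agree u f f' -> agree u g g' -> agree u (f * g) (f' * g').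
Proof.
move=> ff gg m mu; rewrite !coefmM_div; apply: eq_big_seq => a.
rewrite mem_divisors_mon => am; rewrite ff ?gg //.
  exact: msubset_trans (msubsetDl _ _) mu.
exact: msubset_trans am mu.
Qed.

Lemma agree_prod u (I : Type) (r : seq I) (P : pred I) (F G : I -> fps A) :
  (forall i, P i -> agree u (F i) (G i)) ->
  agree u (\prod_(i <- r | P i) F i) (\prod_(i <- r | P i) G i).
Proof.
by move=> FG; apply: (big_rec2 (agree u)) => // i f g Pi; apply: agreeM; apply: FG.
Qed.

(** The linear form sum_l c_l x_l. Infinitely many variables may occur, so it is given by its
    coefficients; modulo [agree u] it becomes the finite sum of [agree_lin_sum]. *)
Definition lin (c : nat -> A) : fps A :=
  Fps (fun u => if (u : seq nat) is [:: l] then c l else 0).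

Lemma coefm_lin_size c u : size u != 1%N -> coefm (lin c) u = 0.
Proof. by rewrite /=; case: (u : seq nat) => [|x []]. Qed.

Lemma size1_mset u : size u = 1%N -> exists l, u = [mset l].
Proof.
case E: (u : seq nat) => [|l []] // _; exists l.
by rewrite -[LHS]seq_mset_id E mset_cons; apply/msetP => x; rewrite mset1DE msetnE
  mset_seqE /= addn0; case: eqP.
Qed.

Lemma coefm_lin1 c l : coefm (lin c) [mset l] = c l.
Proof. by rewrite /= enum_msetn. Qed.

Lemma eq_lin c d : c =1 d -> lin c = lin d.
Proof. by move=> cd; congr lin; apply: funext. Qed.

Lemma linD c d : lin c + lin d = lin (fun l => c l + d l).
Proof.
apply: fpsP => u; rewrite coefmD.
have [/size1_mset[l ->]|n1] := eqVneq (size u) 1%N; first by rewrite !coefm_lin1.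
by rewrite !coefm_lin_size // addr0.
Qed.

Lemma linZ k c : k *: lin c = lin (fun l => k * c l).
Proof.
apply: fpsP => u; rewrite coefmZ.
have [/size1_mset[l ->]|n1] := eqVneq (size u) 1%N; first by rewrite !coefm_lin1.
by rewrite !coefm_lin_size // mulr0.
Qed.

Lemma mono_lin k : mono [mset k] = lin (fun l => (l == k)%:R).
Proof.
apply: fpsP => u.
have [/size1_mset[l ->]|n1] := eqVneq (size u) 1%N.
  rewrite coefm_lin1 /=; congr (_%:R); congr nat_of_bool.
  by apply/eqP/eqP => [/msetP/(_ k)|->//]; rewrite !msetnE eqxx; case: eqP.
by rewrite coefm_lin_size //=; case: eqP => // e; rewrite e size_mset1 in n1.
Qed.

Lemma agree_lin u c d : (forall l, l \in u -> c l = d l) -> agree u (lin c) (lin d).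
Proof.
move=> cd m mu.
have [E|n1] := eqVneq (size m) 1%N; last by rewrite !coefm_lin_size.
have [l El] := size1_mset E; rewrite El !coefm_lin1 cd //.
by rewrite (msubset_subset mu) // El mset11.
Qed.

Lemma agree_lin_sum u N c : (forall l, l \in u -> (l < N)%N) ->
  agree u (lin c) (\sum_(l < N) c l *: mono [mset (l : nat)]).
Proof.
move=> uN.
suff -> : \sum_(l < N) c l *: mono [mset (l : nat)] = lin (fun l => if (l < N)%N then c l else 0).
  by apply: agree_lin => l /uN ->.
apply: fpsP => u'; rewrite coefm_sum.
have [/size1_mset[l ->]|n1] := eqVneq (size u') 1%N; last first.
  by rewrite coefm_lin_size // big1 // => i _; rewrite coefmZ mono_lin coefm_lin_size ?mulr0.
rewrite coefm_lin1; under eq_bigr => i _ do rewrite coefmZ mono_lin coefm_lin1.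
case: ifP => lN.
  rewrite (bigD1 (Ordinal lN)) //= eqxx mulr1 big1 ?addr0 // => i.
  by rewrite -val_eqE /= eq_sym => /negbTE ->; rewrite mulr0.
rewrite big1 // => i _; case: eqP => [e|]; last by rewrite mulr0.
by rewrite e ltn_ord in lN.
Qed.

End Series.

(** * Permutations as words *)

Section Sorting.
Local Open Scope nat_scope.
Variables (n : nat) (r : rel 'I_n).
Hypotheses (r_irr : irreflexive r) (r_tr : transitive r).
Hypothesis r_total : forall x y, x != y -> r x y || r y x.

Let rank v := #|[set v' | r v' v]|.

Let rank_lt v v' : r v v' -> rank v < rank v'.
Proof.
move=> vv'; apply: proper_card; apply/properP; split.
  by apply/subsetP => x; rewrite !inE => /r_tr; apply.
by exists v; rewrite inE ?r_irr.
Qed.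

Let rank_bound v : rank v < n.
Proof.
rewrite -[X in _ < X]card_ord -cardsT; apply: proper_card.
by apply/properP; split=> //; exists v; rewrite ?inE ?r_irr.
Qed.

Let rank_inj : injective (fun v => Ordinal (rank_bound v)).
Proof.
move=> v v' [e]; apply/eqP/negP => /negP/r_total/orP[]/rank_lt; rewrite e ltnn //.
Qed.

(** The rank of an element, the number of its predecessors, is injective by totality; s is the
    inverse of the permutation it defines. *)
Lemma sorting_perm : exists s : 'S_n, forall i j : 'I_n, r (s i) (s j) = (i < j).
Proof.
exists (perm rank_inj)^-1%g => i j.
rewrite -{2}[i](permKV (perm rank_inj)) -{2}[j](permKV (perm rank_inj)).
move: (_ i) (_ j) => {i j} v v'; rewrite !permE /=.
apply/idP/idP; first exact: rank_lt.
apply: contraTT => nr; rewrite -leqNgt.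
have [->//|/r_total/orP[rv|/rank_lt/ltnW//]] := eqVneq v v'.
by rewrite rv in nr.
Qed.

(** In either enumeration the i-th element has exactly i predecessors, and an element is determined
    by its rank. *)
Lemma sorting_perm_uniq (s s' : 'S_n) :
  (forall i j : 'I_n, r (s i) (s j) = (i < j)) ->
  (forall i j : 'I_n, r (s' i) (s' j) = (i < j)) -> s = s'.
Proof.
move=> rs rs'; apply/permP => i.
have card_rank (t : 'S_n) : (forall i j : 'I_n, r (t i) (t j) = (i < j)) ->
    rank (t i) = #|[set j : 'I_n | j < i]|.
  move=> rt; rewrite -(card_imset _ (@perm_inj _ t)); apply: eq_card => x.
  rewrite inE -{1}[x](permKV t) rt; apply/idP/imsetP => [xi|[j]].
    by exists (t^-1 x)%g; rewrite ?inE ?permKV.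
  by rewrite inE => ji ->; rewrite permK.
by apply: rank_inj; apply: val_inj; rewrite /= !card_rank.
Qed.

End Sorting.

(** The value lists of f and g are weakly decreasing rearrangements of each other, hence equal. *)
Lemma antitone_eq_of_card n N (f g : 'I_n -> 'I_N) :
  (forall i j : 'I_n, (i <= j)%N -> (f j <= f i)%N) ->
  (forall i j : 'I_n, (i <= j)%N -> (g j <= g i)%N) ->
  (forall l, #|[set i | f i == l]| = #|[set i | g i == l]|) -> f =1 g.
Proof.
move=> fm gm fg.
have srt (h : 'I_n -> 'I_N) : (forall i j : 'I_n, (i <= j)%N -> (h j <= h i)%N) ->
    sorted (fun x y : 'I_N => (y <= x)%N) (map h (enum 'I_n)).
  move=> hm; apply: (homo_sorted hm).
  by rewrite -sorted_map val_enum_ord iota_sorted.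
have : map f (enum 'I_n) = map g (enum 'I_n).
  apply: (@sorted_eq _ (fun x y : 'I_N => (y <= x)%N)) (srt _ fm) (srt _ gm) _.
  - by move=> y x z /= xy /leq_trans; apply.
  - by move=> x y /= xy; apply: val_inj; apply/eqP; rewrite eqn_leq andbC.
  apply/allP => l _ /=; rewrite (count_map f) (count_map g); apply/eqP.
  have cnt (h : 'I_n -> 'I_N) : count (preim h (pred1 l)) (enum 'I_n) = #|[set i | h i == l]|.
    by rewrite cardsE cardE enumT /enum_mem size_filter; apply: eq_count.
  by rewrite (cnt f) (cnt g) fg.
by move/eq_in_map => e i; apply: e; rewrite mem_enum.
Qed.

(** * Positions inside a block of equal letters *)

Section Blocks.
Local Open Scope nat_scope.
Variables (n N : nat) (w : 'I_n -> 'I_N).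

(** Counting from the end of the block suits the fixed points, which lie there: they will be the
    positions where [later] is below a prescribed number. *)
Definition later (v : 'I_n) := #|[set v' : 'I_n | (v < v') && (w v' == w v)]|.

Definition is_first (v : 'I_n) := [forall v', (w v' == w v) ==> (v <= v')].

Lemma later_lt (v v' : 'I_n) : w v = w v' -> v < v' -> later v' < later v.
Proof.
move=> e lt; apply: proper_card; apply/properP; split.
  by apply/subsetP => x; rewrite !inE e => /andP[/(ltn_trans lt) -> ->].
by exists v'; rewrite !inE ?ltnn // lt e eqxx.
Qed.

Lemma later_bound v : later v < #|[set v' | w v' == w v]|.
Proof.
apply: proper_card; apply/properP; split.
  by apply/subsetP => x; rewrite !inE => /andP[].
by exists v; rewrite !inE ?ltnn ?eqxx.
Qed.

Lemma later_inj l : {in [set v | w v == l] &, injective later}.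
Proof.
move=> v v'; rewrite !inE => /eqP e /eqP e' ll; apply/eqP; apply: contraT => ne.
have := ne; rewrite neq_ltn => /orP[]/later_lt; rewrite e e' ll ltnn; exact.
Qed.

(** [later] maps a block of c positions bijectively onto 0, ..., c - 1. *)
Lemma big_later (R : Type) (idx : R) (op : Monoid.com_law idx) (g : nat -> R) l :
  \big[op/idx]_(v | w v == l) g (later v) =
  \big[op/idx]_(i < #|[set v | w v == l]|) g i.
Proof.
case E: #|[set v | w v == l]| => [|m].
  rewrite big_ord0 big_pred0 // => v; apply/negP => vl.
  by move/eqP: E; rewrite cards_eq0 => /eqP/setP/(_ v); rewrite !inE vl.
have bd v : v \in [set v | w v == l] -> later v < m.+1.
  by rewrite inE => /eqP vl; rewrite -E -vl later_bound.
pose h v : 'I_m.+1 := inord (later v).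
have hinj : {in [set v | w v == l] &, injective h}.
  move=> v v' vl vl' /(congr1 val); rewrite /= !inordK ?bd //.
  exact: later_inj vl vl'.
have hT : h @: [set v | w v == l] = setT.
  by apply/eqP; rewrite eqEcard subsetT cardsT card_ord (card_in_imset hinj) E leqnn.
transitivity (\big[op/idx]_(i in h @: [set v | w v == l]) g i); last first.
  by rewrite hT; apply: eq_bigl => i; rewrite inE.
rewrite (big_imset _ hinj) /=.
apply: eq_big => [v|v vl]; first by rewrite !inE.
by rewrite /h inordK // bd // inE.
Qed.

Lemma is_first_later v : is_first v = (later v == #|[set v' | w v' == w v]|.-1).
Proof.
apply/forallP/eqP => [fv|e v'].
  rewrite (cardsD1 v) inE eqxx /=; apply: eq_card => x; rewrite !inE.
  have := fv x; case: eqP => [e|_ _] //=; last by rewrite !andbF.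
  by rewrite !andbT ltn_neqAle eq_sym => ->; rewrite andbT.
apply/implyP => /eqP e'; rewrite leqNgt; apply/negP => lt.
have := later_bound v'; rewrite e'; have := later_lt e' lt; lia.
Qed.

Lemma card_later_lt l c : c <= #|[set v | w v == l]| ->
  #|[set v | (w v == l) && (later v < c)]| = c.
Proof.
move=> cl; rewrite -sum1dep_card big_mkcondr /=.
rewrite (big_later _ (fun i => if i < c then 1 else 0)) -big_mkcond /=.
by rewrite -(big_ord_widen _ (fun=> 1) cl) sum1_card card_ord.
Qed.

End Blocks.

(** * Compatible permutations and their words *)

Section Words.
Local Open Scope nat_scope.
Variables (n N : nat) (w : 'I_n -> 'I_N).
Hypothesis w_anti : forall i j : 'I_n, i <= j -> w j <= w i.
Implicit Types (s : 'S_n) (y : {ffun 'I_n -> 'I_N * bool}) (a : nat -> nat).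

(** When w is the weakly decreasing word of a monomial, this says that w is counted by F_{Exd(s)};
    see [F_word_valid]. *)
Definition valid s :=
  [forall i : 'I_n, forall j : 'I_n,
     (i < j) && (w i == w j) ==> (barred s i < barred s j)].

Definition fix_content a s :=
  [forall l : 'I_N, #|[set i | (s i == i) && (w i == l)]| == a l].

Definition word_of s : {ffun 'I_n -> 'I_N * bool} :=
  [ffun v => (w (s^-1 v)%g, (s^-1 v)%g < v)].

(* For x = (l, e) at position v, l is the block of s^-1 v and e says whether
   s^-1 v is an excedance.  The fixed points of a block are its last positions,
   and a prescribes their number in each block. *)
Definition good_letter a (v : 'I_n) (x : 'I_N * bool) :=
  if later w v < a (w v) then x == (w v, false)
  else [&& (w v < x.1) ==> x.2, (x.1 < w v) ==> ~~ x.2,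
           ~~ (is_first w v && (x == (w v, true))) &
           ~~ ((later w v == a (w v)) && (x == (w v, false)))].

Definition good a y := [forall v, good_letter a v (y v)].

Definition same_content y :=
  [forall l : 'I_N, #|[set v | (y v).1 == l]| == #|[set v | w v == l]|].

Lemma validP s : reflect (forall i j : 'I_n, i < j -> w i = w j ->
  barred s i < barred s j) (valid s).
Proof.
apply: (iffP forallP) => [H i j ij e|H i].
  by have /forallP/(_ j)/implyP := H i; apply; rewrite ij e eqxx.
by apply/forallP => j; apply/implyP => /andP[ij /eqP]; apply: H.
Qed.

Lemma mem_Exc s (i : 'I_n) : (i \in Exc s) = (i < s i).
Proof. by rewrite inE. Qed.

Lemma barred_mono s (i j : 'I_n) : (barred s i < barred s j) =
  ((i < s i) && ~~ (j < s j)) || (((i < s i) == (j < s j)) && (s i < s j)).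
Proof.
rewrite /barred !mem_Exc; have := ltn_ord (s i); have := ltn_ord (s j).
by case: (i < s i); case: (j < s j) => /=; lia.
Qed.

(** The fixed points of a block form a final segment. If j - 1 is fixed, it is unbarred, so validity
    makes j unbarred with s j > j - 1; unbarred means s j <= j. *)
Lemma valid_fix_up s (i j : 'I_n) : valid s -> s i = i -> i <= j -> w i = w j -> s j = j.
Proof.
move=> /validP vs fi; have [m] := ubnP (j : nat); elim: m j => // m IH j jm ij e.
have [<-//|ne] := eqVneq i j.
have ltij : i < j by rewrite ltn_neqAle ne.
have pj : j.-1 < n by have := ltn_ord j; lia.
pose j' := Ordinal pj.
have wj' : w i = w j'.
  apply: val_inj; apply/eqP; rewrite eqn_leq [X in _ && X]w_anti /=; last by lia.
  by rewrite e w_anti //= leq_pred.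
have fj' : s j' = j' by apply: IH => //=; lia.
have : barred s j' < barred s j by apply: vs; rewrite ?wj' // -?e //=; lia.
rewrite barred_mono fj' ltnn /=; case: ltnP => //= sj lt.
by apply: val_inj => /=; move: sj lt => /=; lia.
Qed.

Lemma valid_fix_later a s v : valid s -> fix_content a s ->
  (s v == v) = (later w v < a (w v)).
Proof.
move=> vs /forallP/(_ (w v))/eqP <-.
apply/idP/idP => [/eqP fv|].
  apply: proper_card; apply/properP; split.
    apply/subsetP => x; rewrite !inE => /andP[vx /eqP e].
    by rewrite e eqxx andbT; apply/eqP; apply: (valid_fix_up vs fv) => //; exact: ltnW.
  by exists v; rewrite !inE ?fv ?ltnn ?eqxx.
apply: contraTT => nf; rewrite -leqNgt; apply: subset_leq_card.
apply/subsetP => x; rewrite !inE => /andP[/eqP fx /eqP e].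
rewrite e eqxx andbT ltnNge; apply/negP => xv; case/negP: nf; apply/eqP.
exact: (valid_fix_up vs fx).
Qed.

(** Let i be the preimage of v. Different blocks of i and v decide their order, as w is decreasing.
    If i is in the block of v, then i < v is impossible for the first v, and i > v is impossible for
    the last non-fixed v, since all later positions of the block are fixed. *)
Lemma word_of_good a s : valid s -> fix_content a s -> good a (word_of s).
Proof.
move=> vs fs; apply/forallP => v; rewrite ffunE /good_letter.
set i := (s^-1 v)%g; have si : s i = v by rewrite permKV.
rewrite -(valid_fix_later v vs fs).
have [fv|nf] := eqVneq (s v) v.
  have -> : i = v by apply: (@perm_inj _ s); rewrite si fv.
  by rewrite ltnn.
apply/and4P; split => /=.
- by apply/implyP; apply: contraLR; rewrite -!leqNgt; apply: w_anti.
- by apply/implyP; apply: contraL => iv; rewrite -leqNgt w_anti // ltnW.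
- apply/negP => /andP[/forallP/(_ i)/implyP H /eqP[e]].
  by have := H (introT eqP e); rewrite leqNgt => /negP.
apply/negP => /andP[/eqP lv /eqP[e /negbT]]; rewrite -leqNgt leq_eqVlt.
case/orP=> [/eqP/val_inj ev|vi]; first by rewrite ev si -ev eqxx in nf.
have : later w i < a (w i) by rewrite e -lv; apply: later_lt.
rewrite -(valid_fix_later i vs fs) si => /eqP ei.
by rewrite ei ltnn in vi.
Qed.

Lemma word_of_content s : same_content (word_of s).
Proof.
apply/forallP => l; apply/eqP; rewrite -[RHS](card_imset _ (@perm_inj _ s)).
apply: eq_card => v; rewrite !inE ffunE /=.
apply/idP/imsetP => [e|[i]]; first by exists (s^-1 v)%g; rewrite ?inE ?permKV.
by rewrite inE => e ->; rewrite permK.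
Qed.

(* Values sorted by the block of their preimage, the excedances of a block
   first: a valid permutation lists the values in this order. *)
Definition word_lt y : rel 'I_n := fun v v' =>
  ((y v').1 < (y v).1) || (((y v).1 == (y v').1) &&
  (((y v).2 && ~~ (y v').2) || (((y v).2 == (y v').2) && (v < v')))).

Lemma word_lt_irr y : irreflexive (word_lt y).
Proof. by move=> v; rewrite /word_lt ltnn !eqxx ltnn /= orbF; case: (_.2). Qed.

Lemma word_lt_tr y : transitive (word_lt y).
Proof.
move=> v2 v1 v3; rewrite /word_lt -!val_eqE /=.
case: (y v1) (y v2) (y v3) => [l1 b1] [l2 b2] [l3 b3] /=.
by case: b1; case: b2; case: b3 => /=; lia.
Qed.

Lemma word_lt_total y v v' : v != v' -> word_lt y v v' || word_lt y v' v.
Proof.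
rewrite /word_lt -!val_eqE /=.
case: (y v) (y v') => [l1 b1] [l2 b2] /=.
by case: b1; case: b2 => /=; lia.
Qed.

Lemma valid_word_lt s : valid s ->
  forall i j : 'I_n, word_lt (word_of s) (s i) (s j) = (i < j).
Proof.
move=> /validP vs.
have up (i j : 'I_n) : i < j -> word_lt (word_of s) (s i) (s j).
  move=> ij; rewrite /word_lt !ffunE !permK /=.
  case: (ltngtP (w j) (w i)) (w_anti (ltnW ij)) => //= /val_inj e _.
  by rewrite e eqxx -barred_mono vs.
move=> i j; apply/idP/idP; last exact: up.
apply: contraTT; rewrite -leqNgt leq_eqVlt => /orP[/eqP/val_inj->|/up ji].
  by rewrite word_lt_irr.
by apply/negP => /(word_lt_tr ji); rewrite word_lt_irr.
Qed.

(** A valid permutation sorts the values by the order [word_lt], which depends on its word alone. *)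
Lemma word_of_inj : {in [pred s | valid s] &, injective word_of}.
Proof.
move=> s s' vs vs' e.
apply: (@sorting_perm_uniq _ (word_lt (word_of s))).
- exact: word_lt_irr.
- exact: word_lt_tr.
- exact: word_lt_total.
- exact: valid_word_lt.
by rewrite e; apply: valid_word_lt.
Qed.

(** * Recovering a permutation from a good word *)

Section Surjectivity.
Variables (a : nat -> nat) (y : {ffun 'I_n -> 'I_N * bool}) (s : 'S_n).
Hypotheses (gy : good a y) (cy : same_content y).
Hypothesis a_le : forall l : 'I_N, a l <= #|[set v | w v == l]|.
Hypothesis s_sorts : forall i j : 'I_n, word_lt y (s i) (s j) = (i < j).

(** Sorting makes the letters of y weakly decrease along s, and y has the content of w. *)
Let letter i : (y (s i)).1 = w i.
Proof.
apply: (antitone_eq_of_card (f := fun i => (y (s i)).1)) i => // [i j|l].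
  rewrite leq_eqVlt => /orP[/eqP/val_inj->//|]; rewrite -s_sorts /word_lt.
  by case/orP=> [/ltnW//|/andP[/eqP-> _]].
move/forallP/(_ l)/eqP: cy => <-; rewrite -[RHS](card_imset _ (@perm_inj _ s^-1)).
apply: eq_card => i; rewrite inE.
apply/idP/imsetP => [e|[v]]; first by exists (s i); rewrite ?inE ?permK.
by rewrite inE => e ->; rewrite permKV.
Qed.

Let goodP v : good_letter a v (y v). Proof. by have /forallP := gy. Qed.

Let up_bar v : w v < (y v).1 -> (y v).2.
Proof.
have := goodP v; rewrite /good_letter; case: ifP => [_ /eqP->|_]; first by rewrite ltnn.
by case/and4P=> /implyP.
Qed.

Let down_unbar v : (y v).1 < w v -> (y v).2 = false.
Proof.
have := goodP v; rewrite /good_letter; case: ifP => [_ /eqP->//|_].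
by case/and4P=> _ /implyP H _ _ /H/negbTE.
Qed.

Let first_unbar v : is_first w v -> y v != (w v, true).
Proof.
have := goodP v; rewrite /good_letter; case: ifP => [_ /eqP->//|_].
  by move=> _; apply/eqP => -[].
by case/and4P=> _ _ /negP H _ fv; apply/negP => e; apply: H; rewrite fv.
Qed.

(** If i and s i lie in different blocks, the local conditions decide. Within one block, a wrong bar
    would make s inject a set J of positions into a strictly smaller set K of values. *)
Let bar i : (y (s i)).2 = (i < s i).
Proof.
set v := s i; have lv : (y v).1 = w i by apply: letter.
have inj_s := @perm_inj _ s.
case: (ltngtP (w i) (w v)) => [lt|gt|/val_inj e].
- rewrite down_unbar ?lv //; apply/esym/negbTE; apply: contraL lt => iv.
  by rewrite -leqNgt w_anti // ltnW.
- rewrite up_bar ?lv //; apply/esym; apply: contraTT gt; rewrite -!leqNgt.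
  exact: w_anti.
have nlt (x x' : 'I_n) : x <= x' -> word_lt y (s x) (s x') || (s x == s x').
  by rewrite s_sorts (inj_eq inj_s) leq_eqVlt orbC.
case bv : (y v).2; apply/esym.
- rewrite ltnNge; apply/negP => vi.
  pose J := [set j : 'I_n | (w j == w i) && (j <= i)].
  pose K := [set x : 'I_n | [&& w x == w i, x <= v & ~~ is_first w x]].
  have JK : s @: J \subset K.
    apply/subsetP => _ /imsetP[j + ->]; rewrite !inE => /andP[/eqP wj ji].
    have /orP[|/eqP/inj_s ej] := nlt _ _ ji; last first.
      rewrite ej -/v e eqxx leqnn; apply/negP => fv.
      by have := first_unbar fv; rewrite [y v]surjective_pairing bv lv e eqxx.
    rewrite /word_lt -/v !letter wj ltnn eqxx bv andbF /=.
    case bj: (y (s j)).2 => //= jv; rewrite (ltnW jv).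
    (* From s j < v the block of s j has a letter at least w i; a smaller letter of y at s j would
       force it to be unbarred. *)
    have wjv : w (s j) = w i.
      apply: val_inj; apply/eqP; rewrite eqn_leq {2}e (w_anti (ltnW jv)) andbT.
      by rewrite -wj -(letter j) leqNgt; apply/negP => /down_unbar; rewrite bj.
    rewrite wjv eqxx /=; apply/negP => fj.
    by have := first_unbar fj; rewrite [y _]surjective_pairing bj letter wj wjv eqxx.
  have KJ : K \proper J.
    apply/properP; split.
      apply/subsetP => x; rewrite !inE => /and3P[-> xv _] /=.
      exact: leq_trans xv vi.
    have [f wf fmin] := @arg_minnP _ v (fun x => w x == w v) (@nat_of_ord n) (eqxx _).
    exists f; rewrite !inE e wf /=; first by rewrite (leq_trans (fmin v _)) ?eqxx.
    rewrite negb_and negbK; apply/orP; right; apply/forallP => x; apply/implyP.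
    by rewrite (eqP wf) => /fmin.
  have := proper_card KJ; have := subset_leq_card JK.
  by rewrite card_imset // => H1 H2; have := leq_ltn_trans H1 H2; rewrite ltnn.
apply/negbTE/negP => iv.
(* The mirror image: positions from i on would go to values from v on, all unbarred, although i <
   v. *)
pose J := [set j : 'I_n | (w j == w i) && (i <= j)].
pose K := [set x : 'I_n | (w x == w i) && (v <= x)].
have JK : s @: J \subset K.
  apply/subsetP => _ /imsetP[j + ->]; rewrite !inE => /andP[/eqP wj ij].
  have /orP[|/eqP/inj_s ej] := nlt _ _ ij; last by rewrite -ej -/v e eqxx leqnn.
  rewrite /word_lt -/v !letter wj ltnn eqxx bv /=.
  case bj: (y (s j)).2 => //= jv; rewrite (ltnW jv) andbT.
  apply/eqP/val_inj; apply/eqP; rewrite eqn_leq {1}e (w_anti (ltnW jv)) /=.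
  by rewrite -wj -(letter j) leqNgt; apply/negP => /up_bar; rewrite bj.
have KJ : K \proper J.
  apply/properP; split.
    by apply/subsetP => x; rewrite !inE => /andP[-> /(leq_trans (ltnW iv))].
  by exists i; rewrite !inE eqxx ?leqnn //= -ltnNge.
have := proper_card KJ; have := subset_leq_card JK.
by rewrite card_imset // => H1 H2; have := leq_ltn_trans H1 H2; rewrite ltnn.
Qed.

Let sort_valid : valid s.
Proof.
apply/validP => i j; rewrite -s_sorts /word_lt !letter !bar => + e.
by rewrite e ltnn eqxx barred_mono.
Qed.

Let sort_word : word_of s = y.
Proof.
apply/ffunP => v; have [i ->] : exists i, v = s i by exists (s^-1 v)%g; rewrite permKV.
by rewrite ffunE permK [RHS]surjective_pairing letter bar.
Qed.

(** Both directions take the largest counterexample x. If x is fixed too early, either x is the last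
    position not prescribed as fixed, where y cannot be (w x, false), or the next position of the
    block is a larger counterexample. If x should be fixed but is not, y x = (w x, false) puts its
    preimage later in the same block, again a larger counterexample. *)
Let sort_fix v : (s v == v) = (later w v < a (w v)).
Proof.
apply/idP/idP => [/eqP fv|lv].
  rewrite ltnNge; apply/negP => av.
  pose P x := [&& s x == x, w x == w v & a (w v) <= later w x].
  have Pv : P v by rewrite /P fv !eqxx av.
  have [x /and3P[/eqP fx /eqP wx ax] xmax] := @arg_maxnP _ v P (@nat_of_ord n) Pv.
  have yx : y x = (w x, false).
    by rewrite [y x]surjective_pairing -{1 2}fx letter bar fx ltnn.
  move: ax; rewrite leq_eqVlt => /orP[/eqP ex|lt].
    by have := goodP x; rewrite /good_letter wx -ex ltnn yx wx => /and4P[_ _ _]; rewrite !eqxx.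
  have : later w x > 0 by apply: leq_ltn_trans lt.
  case/card_gt0P => z0; rewrite inE => Pz0.
  have [z /andP[xz /eqP wz] zmin] :=
    @arg_minnP _ z0 (fun z => (x < z) && (w z == w x)) (@nat_of_ord n) Pz0.
  have step : later w x <= (later w z).+1.
    rewrite [later w x]/later (cardsD1 z) inE xz wz eqxx /= add1n ltnS.
    apply: subset_leq_card; apply/subsetP => t; rewrite !inE.
    case/and3P=> tz xt /eqP wt; rewrite wt wz eqxx andbT ltn_neqAle eq_sym tz.
    by apply: zmin; rewrite xt wt eqxx.
  have : P z.
    rewrite /P wz wx eqxx -ltnS (leq_trans lt step) !andbT.
    by apply/eqP; apply: (valid_fix_up sort_valid fx); rewrite ?wz // ltnW.
  by move/xmax => /(leq_trans xz); rewrite ltnn.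
apply: contraT => nf.
pose P x := (s x != x) && (later w x < a (w x)).
have Pv : P v by rewrite /P nf lv.
have [x /andP[nfx lx] xmax] := @arg_maxnP _ v P (@nat_of_ord n) Pv.
pose i := (s^-1 x)%g; have si : s i = x by rewrite permKV.
have := goodP x; rewrite /good_letter lx -si => /eqP [] yi.
have ex : (y (s i)).2 = false by rewrite yi.
have wi : w i = w x by rewrite -letter yi si.
have xi : x < i.
  rewrite ltn_neqAle; apply/andP; split; last by rewrite leqNgt -{1}si -bar ex.
  by apply: contraNneq nfx => /val_inj e; rewrite {1}e si.
have li : later w i < a (w i).
  by rewrite wi; apply: ltn_trans lx; apply: later_lt.
have [fi|nfi] := eqVneq (s i) i; first by rewrite -si fi ltnn in xi.
have Pi : P i by rewrite /P nfi li.
by have := leq_trans xi (xmax i Pi); rewrite ltnn.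
Qed.

Lemma sorting_perm_word : [/\ valid s, fix_content a s & word_of s = y].
Proof.
split=> //; apply/forallP => l; apply/eqP.
rewrite -[RHS](card_later_lt (a_le l)); apply: eq_card => v.
by rewrite !inE sort_fix andbC; case: eqP => // ->.
Qed.

End Surjectivity.

Lemma word_of_image a : (forall l : 'I_N, a l <= #|[set v | w v == l]|) ->
  word_of @: [set s | valid s && fix_content a s] =
  [set y | good a y && same_content y].
Proof.
move=> al; apply/setP => y; rewrite inE; apply/imsetP/andP => [[s]|[gy cy]].
  by rewrite inE => /andP[vs fs] ->; rewrite word_of_good ?word_of_content.
have [s sP] := sorting_perm (@word_lt_irr y) (@word_lt_tr y) (@word_lt_total y).
have [vs fs e] := sorting_perm_word gy cy al sP.
by exists s; rewrite ?inE ?vs.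
Qed.

Lemma exc_word_of s : #|[set v | (word_of s v).2]| = exc s.
Proof.
rewrite /exc -[RHS](card_imset _ (@perm_inj _ s)); apply: eq_card => v.
rewrite inE ffunE /=; apply/idP/imsetP => [e|[i]].
  by exists (s^-1 v)%g; rewrite ?inE permKV.
by rewrite inE => e ->; rewrite permK.
Qed.

Lemma sum_valid_word (R : Type) (idx : R) (op : Monoid.com_law idx) a (F : nat -> R) :
  (forall l : 'I_N, a l <= #|[set v | w v == l]|) ->
  \big[op/idx]_(s | valid s && fix_content a s) F (exc s) =
  \big[op/idx]_(y | good a y && same_content y) F #|[set v | (y v).2]|.
Proof.
move=> al; transitivity (\big[op/idx]_(y in word_of @: [set s | valid s && fix_content a s])
    F #|[set v | (y v).2]|).
  rewrite big_imset /=.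
    by apply: eq_big => s; rewrite ?inE // exc_word_of.
  by move=> s s'; rewrite !inE => /andP[vs _] /andP[vs' _]; apply: word_of_inj.
by rewrite word_of_image //; apply: eq_bigl => y; rewrite inE.
Qed.

End Words.

(** * The coefficients of the derangement series *)

Section MoreMonomials.
Variable A : comNzRingType.
Implicit Types (a u : monomial).

Lemma monoX k b : mono A [mset b] ^+ k = mono A (msetn k b).
Proof.
elim: k => [|k IH]; first by rewrite expr0 msetn0.
rewrite exprS IH monoM; congr mono; apply/msetP => x.
by rewrite mset1DE !msetnE; case: eqP.
Qed.

Lemma seq_mset_filterE (p : pred nat) a x :
  seq_mset [seq b <- a | p b] x = if p x then a x else 0%N.
Proof.
rewrite mset_seqE count_filter; case px: (p x).
  rewrite -count_mem_mset; apply: eq_count => y /=.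
  by case: eqP => // ->.
apply/eqP; rewrite -leqn0 leqNgt -has_count; apply/hasPn => y _ /=.
by case: eqP => // ->; rewrite px.
Qed.

Lemma mono_prodX N a : (forall l, l \in a -> (l < N)%N) ->
  \prod_(b < N) mono A [mset (b : nat)] ^+ a b = mono A a.
Proof.
move=> aN; transitivity (mono A (seq_mset [seq b <- a | (b < N)%N])); last first.
  by rewrite (all_filterP _) ?seq_mset_id //; apply/allP => l /aN.
elim: {aN} N => [|N IH].
  rewrite big_ord0 -mono0; congr mono; apply/msetP => x.
  by rewrite seq_mset_filterE mset0E.
rewrite big_ord_recr /= IH monoX monoM; congr mono; apply/msetP => x.
rewrite msetE2 !seq_mset_filterE msetnE ltnS.
by case: (ltngtP x N) => [||->]; rewrite ?addn0.
Qed.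

Lemma size_mset_sum N a : (forall l, l \in a -> (l < N)%N) ->
  size a = (\sum_(b < N) a b)%N.
Proof.
move=> aN; rewrite -[LHS](count_predT a).
transitivity (\sum_(b < N) count_mem (b : nat) a)%N; last first.
  by apply: eq_bigr => b _; rewrite count_mem_mset.
have {aN}: forall l, l \in (a : seq nat) -> (l < N)%N by move=> l la; apply: aN.
elim: (a : seq nat) => [|x s IH] aN; first by rewrite /= big1.
rewrite /= IH; last by move=> l ls; apply: aN; rewrite inE ls orbT.
rewrite big_split /=; congr (_ + _)%N.
have xN : (x < N)%N by apply: aN; rewrite mem_head.
rewrite (bigD1 (Ordinal xN)) //= eqxx big1 // => i.
by rewrite -val_eqE /= eq_sym => /negbTE ->.
Qed.

End MoreMonomials.

(* A divisor of u is a choice, for each letter b, of a multiplicity at most u b. *)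
Lemma sum_divisors_prod (B : comNzRingType) N (u : monomial) (g : nat -> nat -> B) :
  (forall l, l \in u -> (l < N)%N) ->
  \sum_(a <- divisors_mon u) \prod_(b < N) g b (a b) =
  \prod_(b < N) \sum_(i < (u b).+1) g b i.
Proof.
move=> uN; pose M := size u.
have uM b : (u b <= M)%N by rewrite -count_mem_mset count_size.
transitivity (\prod_(b < N) \sum_(i < M.+1 | (i < (u b).+1)%N) g b i); last first.
  by apply: eq_bigr => b _; rewrite -(big_ord_widen _ (g b)) // ltnS.
rewrite (bigA_distr_big_dep (fun (b : 'I_N) (i : 'I_M.+1) => (i < (u b).+1)%N)) /=.
(* Multiplicities in divisors of u are at most M, so [inord] loses nothing; [toF] matches the
   divisors with the choice functions of the expanded product. *)
pose toF (a : monomial) : {ffun 'I_N -> 'I_M.+1} := [ffun b : 'I_N => inord (a b)].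
have toFE a b : a `<=` u -> toF a b = a b :> nat.
  by move=> /msubsetP au; rewrite ffunE inordK // ltnS (leq_trans (au b)).
set fam := family _.
have pe : perm_eq [seq toF a | a <- divisors_mon u] (enum fam).
  apply: uniq_perm; last first.
  - move=> f; rewrite mem_enum; apply/mapP/familyP => [[a au ->] b|fu].
      rewrite mem_divisors_mon in au.
      by rewrite unfold_in toFE // ltnS; move/msubsetP: au.
    pose a : monomial := seq_mset (flatten [seq nseq (f b) (b : nat) | b <- enum 'I_N]).
    have aE (b : 'I_N) : a b = f b.
      rewrite mset_seqE count_flatten -map_comp sumnE big_map big_enum /=.
      rewrite (bigD1 b) //= count_nseq /= eqxx mul1n big1 ?addn0 // => c.
      by rewrite -val_eqE /= count_nseq /= => /negbTE ->.
    have au : a `<=` u.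
      apply/msubsetP => l; case: (ltnP l N) => lN.
        by have := fu (Ordinal lN); rewrite unfold_in ltnS -aE.
      rewrite (_ : a l = 0%N) // mset_seqE; apply/count_memPn.
      apply/flattenP => -[_ /mapP[b _ ->]]; rewrite mem_nseq => /andP[_ /eqP e].
      by rewrite e leqNgt ltn_ord in lN.
    by exists a; rewrite ?mem_divisors_mon //; apply/ffunP => b; apply: val_inj; rewrite /= toFE.
  - exact: enum_uniq.
  rewrite map_inj_in_uniq ?divisors_mon_uniq // => a b.
  rewrite !mem_divisors_mon => au bu e; apply/msetP => l.
  case: (ltnP l N) => lN.
    by rewrite -(toFE a (Ordinal lN)) // e toFE.
  have: l \notin u by apply/negP => /uN; rewrite ltnNge lN.
  rewrite -mset_eq0 => /eqP ul.
  move/msubsetP/(_ l): au; move/msubsetP/(_ l): bu; rewrite ul !leqn0.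
  by move=> /eqP-> /eqP->.
rewrite -[RHS]big_enum -(perm_big _ pe) /= big_map.
apply: eq_big_seq => a; rewrite mem_divisors_mon => au.
by apply: eq_bigr => b _; rewrite toFE.
Qed.

Section Transfer.
Variables (A : comNzRingType) (t : A).
Implicit Types (a u : monomial).

Local Notation x b := (mono A [mset (b : nat)]).

(* In the notation of the header, [letters b] is T_b and [upto b] is T_b - x_b. *)
Definition upto (b : nat) : fps A := lin (fun l => if (l < b)%N then 1 else t).

Definition letters (b : nat) : fps A := upto b + x b.

(** Both sides are T_b, so [upto b.+1] is T_b - t x_b. *)
Lemma upto_succ b : upto b + x b = upto b.+1 + t *: x b.
Proof.
rewrite /upto mono_lin linZ !linD; apply: eq_lin => l /=.
by rewrite ltnS; case: ltngtP => _ /=; rewrite ?mulr0 ?mulr1 ?addr0 // addrC.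
Qed.

(* The fixed-point free words on a block of c letters b: the first letter is not
   an excedance that stays in the block, the last one not a non-excedance that
   stays in the block. *)
Definition block_fps (b c : nat) : fps A :=
  match c with
  | 0 => 1
  | 1 => upto b - t *: x b
  | c.+2 => upto b * letters b ^+ c * upto b.+1
  end.

(** Here i counts the fixed points of the block. In the induction the term i = 0 is upto_b T_b^c
    upto_{b+1}, the others give x_b T_b^c upto_{b+1}, and upto_b + x_b = T_b. *)
Lemma sum_block b c :
  \sum_(i < c.+2) x b ^+ i * block_fps b (c.+1 - i) = letters b ^+ c * upto b.+1.
Proof.
have e : upto b.+1 = upto b + x b - t *: x b by rewrite upto_succ addrK.
elim: c => [|c IH].
  rewrite !big_ord_recl big_ord0 /bump /= ?subn0 ?subnn !expr0 /= expr1 e; ring.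
rewrite big_ord_recl /= ?subn0 expr0 mul1r.
under eq_bigr => i _ do rewrite /bump /= add1n subSS exprS -mulrA.
by rewrite -big_distrr /= IH exprS /letters; ring.
Qed.

(** As before, but each fixed point has weight t, so the factor completed to T_b is upto_{b+1} + t
    x_b, and upto_b survives. *)
Lemma sum_block_t b c :
  \sum_(i < c.+2) (t *: x b) ^+ i * block_fps b (c.+1 - i) = letters b ^+ c * upto b.
Proof.
have e : upto b.+1 = upto b + x b - t *: x b by rewrite upto_succ addrK.
elim: c => [|c IH].
  rewrite !big_ord_recl big_ord0 /bump /= ?subn0 ?subnn !expr0 /= expr1; ring.
rewrite big_ord_recl /= ?subn0 expr0 mul1r.
under eq_bigr => i _ do rewrite /bump /= add1n subSS exprS -mulrA.
by rewrite -big_distrr /= IH exprS e /letters; ring.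
Qed.

Definition mon_bound u : nat := (\max_(l <- u) l).+1.

Lemma mon_boundP u l : l \in u -> (l < mon_bound u)%N.
Proof. by move=> lu; rewrite ltnS; exact: (@leq_bigmax_seq _ (u : seq nat) xpredT id l lu). Qed.

(* The weight t^exc of the derangements that are compatible with u. *)
Definition derange u : A := coefm (\prod_(b < mon_bound u) block_fps b (u b)) u.

Lemma derange_bound u N : (forall l, l \in u -> (l < N)%N) ->
  derange u = coefm (\prod_(b < N) block_fps b (u b)) u.
Proof.
move=> uN; rewrite /derange; congr coefm.
have widen m m' : (m <= m')%N -> (forall l, l \in u -> (l < m)%N) ->
    \prod_(b < m) block_fps b (u b) = \prod_(b < m') block_fps b (u b).
  move=> mm um; rewrite (big_ord_widen _ (fun b => block_fps b (u b)) mm).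
  rewrite big_mkcond; apply: eq_bigr => b _; case: ifP => // bm.
  by rewrite (eqP (_ : u b == 0%N)) // mset_eq0; apply/negP => /um; rewrite bm.
have [le|/ltnW le] := leqP N (mon_bound u); last by apply: widen => // l /mon_boundP.
by symmetry; apply: widen.
Qed.

Lemma derange0 : derange mset0 = 1.
Proof.
rewrite (@derange_bound _ 0) => [|l]; last by rewrite in_mset0.
by rewrite big_ord0 coefm1 eqxx.
Qed.

(** Multiplying by the monomial a moves the extraction to u itself, so that the sum over all
    divisors can be taken inside a single coefficient. *)
Lemma derange_sub u a N : a `<=` u -> (forall l, l \in u -> (l < N)%N) ->
  derange (u `\` a) =
  coefm (\prod_(b < N) (x b ^+ a b * block_fps b (u b - a b))) u.
Proof.
move=> au uN; rewrite big_split mono_prodX; last first.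
  by move=> l /(msubset_subset au)/uN.
rewrite coefm_monoM au (@derange_bound _ N) => [|l]; last first.
  by move/(msubset_subset (msubsetDl _ _))/uN.
by congr coefm; apply: eq_bigr => b _; rewrite msetE2.
Qed.

Lemma sum_derange (z : A) u N : (forall l, l \in u -> (l < N)%N) ->
  \sum_(a <- divisors_mon u) z ^+ size a * derange (u `\` a) =
  coefm (\prod_(b < N) \sum_(i < (u b).+1) (z *: x b) ^+ i * block_fps b (u b - i)) u.
Proof.
move=> uN.
rewrite -(sum_divisors_prod (fun b i => (z *: x b) ^+ i * block_fps b (u b - i)) uN).
rewrite coefm_sum; apply: eq_big_seq => a; rewrite mem_divisors_mon => au.
have aN l : l \in (a : monomial) -> (l < N)%N by move/(msubset_subset au)/uN.
rewrite (derange_sub au uN) (size_mset_sum aN) -prodrXr -coefmZ; congr coefm.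
by rewrite -scaler_prod; apply: eq_bigr => b _; rewrite exprZn scalerAl.
Qed.

Lemma path_ltn_last b0 s l : path ltn b0 s -> l \in b0 :: s -> (l <= last b0 s)%N.
Proof.
elim: s b0 l => [|b1 s IH] b0 l /=; first by rewrite inE => _ /eqP->.
case/andP=> b01 ps; rewrite inE => /orP[/eqP->|/(IH _ _ ps)//].
by apply: leq_trans (ltnW b01) (IH _ _ ps _); rewrite mem_head.
Qed.

(** For consecutive letters b < b' of the list, [upto b'] and [upto b.+1] differ only at letters
    strictly between them, which do not occur in u. *)
Lemma upto_telescope u b0 s : path ltn b0 s ->
  (forall l, l \in u -> (l <= b0)%N || (l \in s)) ->
  agree u (\prod_(b <- s) upto b) (\prod_(b <- belast b0 s) upto b.+1).
Proof.
elim: s b0 => [|b1 s IH] b0 /=; first by rewrite !big_nil.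
case/andP=> b01 ps us; rewrite !big_cons; apply: agreeM; last first.
  apply: IH => // l /us; rewrite inE => /or3P[l0|/eqP->|->]; rewrite ?leqnn ?orbT //.
  by rewrite (leq_trans l0 (ltnW b01)).
apply: agree_lin => l /us; rewrite ltnS inE => /or3P[l0|/eqP->|ls].
- by rewrite l0 (leq_ltn_trans l0).
- by rewrite ltnn leqNgt b01.
have b1l : (b1 < l)%N by move/(order_path_min ltn_trans)/allP: ps; apply.
by rewrite ltnNge (ltnW b1l) leqNgt (ltn_trans b01 b1l).
Qed.

(** The telescope shifts every factor but one. On the letters of u, [upto] of the first letter is t
    times the sum of the variables and [upto] past the last letter is that sum. *)
Lemma upto_rotate u s : sorted ltn s -> s != [::] -> {subset u <= s} ->
  agree u (\prod_(b <- s) upto b) (t *: \prod_(b <- s) upto b.+1).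
Proof.
case: s => // b0 s ps _ us.
have -> : \prod_(b <- b0 :: s) upto b.+1 =
    upto (last b0 s).+1 * \prod_(b <- belast b0 s) upto b.+1.
  by rewrite lastI big_rcons /= mulrC.
rewrite big_cons scalerAl; apply: agreeM; last first.
  by apply: upto_telescope => // l /us; rewrite inE => /orP[/eqP->|->]; rewrite ?leqnn ?orbT.
rewrite /upto linZ; apply: agree_lin => l /us ls.
have -> : (l < b0)%N = false.
  move: ls; rewrite inE => /orP[/eqP->|ls]; first by rewrite ltnn.
  by apply/negbTE; rewrite -leqNgt ltnW //; move/(order_path_min ltn_trans)/allP: ps; apply.
by rewrite ltnS (path_ltn_last ps) // mulr1.
Qed.

(* MacMahon's master theorem for the matrix of [letters], modified by the block
   factors; both sums are products over the blocks that differ by [upto_rotate]. *)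
Lemma sum_derange_t u : u != mset0 ->
  \sum_(a <- divisors_mon u) t ^+ size a * derange (u `\` a) =
  t * \sum_(a <- divisors_mon u) derange (u `\` a).
Proof.
move=> u0; pose N := mon_bound u; have uN : forall l, l \in u -> (l < N)%N := @mon_boundP u.
transitivity (t * \sum_(a <- divisors_mon u) 1 ^+ size a * derange (u `\` a)); last first.
  by congr (_ * _); apply: eq_bigr => a _; rewrite expr1n mul1r.
rewrite !(sum_derange _ uN).
(* Both products share the factor L of powers of T_b; the remaining factors are [upto b] on one side
   and [upto b.+1] on the other, for b in the support s of u. *)
pose s := [seq b <- iota 0 N | b \in u].
pose L := \prod_(b <- s) letters b ^+ (u b).-1.
have prodE (F G : nat -> fps A) : (forall b, u b = 0%N -> F b = 1) ->
    (forall b, b \in u -> F b = letters b ^+ (u b).-1 * G b) ->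
    \prod_(b < N) F b = L * \prod_(b <- s) G b.
  move=> F0 FG; rewrite /L -big_split /= -(big_mkord xpredT) /index_iota subn0.
  rewrite big_filter [RHS]big_mkcond /=; apply: eq_bigr => b _.
  by case: ifP => [/FG->//|/negbT]; rewrite -mset_eq0 => /eqP/F0.
pose F (z : A) (b : nat) := \sum_(i < (u b).+1) (z *: x b) ^+ i * block_fps b (u b - i).
rewrite (prodE (F t) upto) /F => [|b ->|b]; last 2 first.
- by rewrite big_ord_recl big_ord0 addr0 expr0 mul1r.
- by rewrite -mset_gt0; case: (u b) => // c _; rewrite sum_block_t.
rewrite (prodE (F 1) (fun b => upto b.+1)) /F => [|b ->|b]; last 2 first.
- by rewrite big_ord_recl big_ord0 addr0 expr0 mul1r.
- by rewrite -mset_gt0; case: (u b) => // c _; rewrite !scale1r sum_block.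
rewrite -coefmZ scalerAr; apply: (_ : agree u _ _); last exact: msubset_refl.
apply: agreeM => //; apply: upto_rotate.
- by apply: sorted_filter (iota_ltn_sorted _ _); apply: ltn_trans.
- have [/eqP|[l lu]] := mset_0Vmem u; first by rewrite (negbTE u0).
  have : l \in s by rewrite mem_filter mem_iota lu uN.
  by apply: contraTneq => ->.
by move=> l lu; rewrite mem_filter mem_iota lu uN.
Qed.

End Transfer.

(** Grouping [sum_derange_t] by the size m of the divisor gives sum_m (t^m - t) H_m = 0. The term m
    = 0 is (1 - t) times the left side, every other one is divisible by 1 - t, and 1 - t can be
    cancelled over a domain. *)
Lemma derange_rec (R : idomainType) (u : monomial) : u != mset0 ->
  derange 'X u = \sum_(m < size u) 'X * (\sum_(i < m) 'X^i) *
    \sum_(a <- divisors_mon u | size a == m.+1) derange ('X : {poly R}) (u `\` a).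
Proof.
move=> u0; pose H m := \sum_(a <- divisors_mon u | size a == m) derange ('X : {poly R}) (u `\` a).
have bySize (F : nat -> {poly R}) :
    \sum_(a <- divisors_mon u) F (size a) * derange ('X : {poly R}) (u `\` a) =
    \sum_(m < (size u).+1) F m * H m.
  transitivity (\sum_(a <- divisors_mon u) \sum_(m < (size u).+1 | size a == m)
     F m * derange ('X : {poly R}) (u `\` a)).
    apply: eq_big_seq => a; rewrite mem_divisors_mon => /size_msub au.
    by rewrite (big_pred1 (Ordinal (au : (size (a : monomial) < (size u).+1)%N))) // => m;
       rewrite -val_eqE /= eq_sym.
  rewrite (exchange_big_dep xpredT) //=; apply: eq_bigr => m _.
  by rewrite mulr_sumr; apply: eq_bigr.
have X1 : 1 - 'X != 0 :> {poly R}.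
  rewrite subr_eq0; apply/eqP => /(congr1 (fun p : {poly R} => p`_0)) /eqP.
  by rewrite coefX coef1 oner_eq0.
apply: (mulfI X1); apply/eqP; rewrite -subr_eq0; apply/eqP.
have := sum_derange_t ('X : {poly R}) u0.
have -> : \sum_(a <- divisors_mon u) derange ('X : {poly R}) (u `\` a) =
    \sum_(m < (size u).+1) 1 * H m.
  by rewrite -(bySize (fun=> 1)); apply: eq_bigr => a _; rewrite mul1r.
rewrite (bySize (fun m => 'X^m)) => /eqP; rewrite -subr_eq0 => /eqP key; rewrite -[RHS]key.
have H0 : H 0%N = derange 'X u.
  rewrite /H -big_filter (_ : filter _ _ = [:: mset0]) ?big_seq1 ?msetB0 //.
  rewrite -(@filter_pred1_uniq _ (divisors_mon u)) ?divisors_mon_uniq //;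
    last by rewrite mem_divisors_mon msub0set.
  by apply: eq_filter => a; rewrite /= size_mset_eq0.
transitivity (\sum_(m < (size u).+1) ('X^m - 'X) * H m).
  rewrite big_ord_recl expr0 H0; congr (_ + _).
  rewrite mulr_sumr -sumrN; apply: eq_bigr => m _.
  rewrite -[H m.+1]/(\sum_(a <- divisors_mon u | size a == m.+1) _).
  have -> : 'X^(lift ord0 m) - 'X = - ((1 - 'X) * ('X * \sum_(i < m) 'X^i)) :> {poly R}.
    by rewrite mulrCA -mulrN -mulNr opprB -subrX1 mulrBr mulr1 -exprS.
  by rewrite mulNr !mulrA.
rewrite mulr_sumr -sumrB; apply: eq_bigr => m _.
by rewrite mul1r mulrBl.
Qed.

(** * Counting words by coefficient extraction *)

Section CountWords.
Variables (A : comNzRingType) (t : A) (n N : nat) (w : 'I_n -> 'I_N).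
Variables (u a : monomial).
Hypothesis uw : forall l : 'I_N, #|[set v | w v == l]| = u l.
Hypothesis uN : forall l, l \in u -> (l < N)%N.
Hypothesis au : a `<=` u.

Local Notation x b := (mono A [mset (b : nat)]).

(** The weighted sum of the good letters at the position of block b followed by i others. From T_b
    one removes t x_b at the first position, i = u_b - 1, and x_b at the last non-fixed one, i =
    a_b. *)
Definition letter_fps (b i : nat) : fps A :=
  if (i < a b)%N then x b
  else letters t b - (i == (u b).-1)%:R *: (t *: x b) - (i == a b)%:R *: x b.

Lemma prod_letter_fps b :
  \prod_(i < u b) letter_fps b i = x b ^+ a b * block_fps t b (u b - a b).
Proof.
have /msubsetP/(_ b)/subnKC e := au; rewrite /letter_fps.
move: (u b - a b)%N e => d <-.
rewrite big_split_ord /=; congr (_ * _).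
  rewrite -[in RHS](card_ord (a b)) -prodr_const; apply: eq_bigr => i _.
  by rewrite ltn_ord.
under eq_bigr => i _ do rewrite ltnNge leq_addr /=.
(* For d = 1 the only non-fixed position is both first and last, and both exclusions hit the same
   factor; for larger d they hit the two end factors. *)
case: d => [|[|d]]; first by rewrite big_ord0.
  have e1 : (a b + 0 == (a b + 1).-1)%N by apply/eqP; lia.
  have e2 : (a b + 0 == a b)%N by apply/eqP; lia.
  rewrite big_ord1 /= e1 e2 !scale1r.
  by rewrite /letters; ring.
rewrite big_ord_recr big_ord_recl /=.
have e1 : (a b + 0 == (a b + d.+2).-1)%N = false by apply/eqP; lia.
have e2 : (a b + 0 == a b)%N by apply/eqP; lia.
have e3 : (a b + d.+1 == (a b + d.+2).-1)%N by apply/eqP; lia.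
have e4 : (a b + d.+1 == a b)%N = false by apply/eqP; lia.
rewrite e1 e2 e3 e4 !scale1r !scale0r !subr0.
have <- : upto t b.+1 = letters t b - t *: x b by rewrite /letters upto_succ addrK.
rewrite /letters addrK; congr (_ * _ * _).
transitivity (\prod_(i < d) letters t b); last by rewrite prodr_const card_ord.
apply: eq_bigr => i _; have := ltn_ord i; rewrite /bump /= => id.
have -> : (a b + (1 + i) == (a b + d.+2).-1)%N = false by apply/eqP; lia.
have -> : (a b + (1 + i) == a b)%N = false by apply/eqP; lia.
by rewrite !scale0r !subr0.
Qed.

Definition letter_weight (v : 'I_n) (z : 'I_N * bool) : A :=
  (good_letter w a v z)%:R * t ^+ z.2.

Lemma letter_fps_agree v : agree u (letter_fps (w v) (later w v))
  (\sum_(z : 'I_N * bool) letter_weight v z *: x z.1).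
Proof.
pose g l : A := if (later w v < a (w v))%N then (l == w v :> nat)%:R
  else (if (l < w v)%N then 1 else t) + (l == w v :> nat)%:R
    - (later w v == (u (w v)).-1)%:R * (t * (l == w v :> nat)%:R)
    - (later w v == a (w v))%:R * (l == w v :> nat)%:R.
have -> : letter_fps (w v) (later w v) = lin g.
  rewrite /letter_fps /g; case: ifP => _; rewrite /letters /upto mono_lin //.
  by rewrite -!scaleN1r !linZ !linD; apply: eq_lin => l; rewrite !mulN1r.
have -> : \sum_(z : 'I_N * bool) letter_weight v z *: x z.1 =
          \sum_(l < N) g l *: x l.
  rewrite -(pair_bigA _ (fun l b => letter_weight v (l, b) *: x l)) /=.
  apply: eq_bigr => l _; rewrite big_bool /= -scalerDl; congr (_ *: _).
  rewrite /letter_weight /good_letter /g /= expr0 expr1 mulr1.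
  rewrite is_first_later uw !xpair_eqE -val_eqE.
  case: ifP => _; first by rewrite andbF /= andbT mul0r add0r.
  case: (later w v == (u (w v)).-1); case: (later w v == a (w v));
    case: (ltngtP l (w v)) => lw /=;
    rewrite ?andbF ?andbT ?mulr0 ?mul0r /=; ring.
exact: agree_lin_sum.
Qed.

(** Expanding the product over the positions yields one term per word y: the coefficient of u
    selects the content, and the weights select good words and record their bars. *)
Lemma sum_words :
  \sum_(y : {ffun 'I_n -> 'I_N * bool} | good w a y && same_content w y)
     t ^+ #|[set v | (y v).2]| = derange t (u `\` a).
Proof.
rewrite (derange_sub _ au uN); symmetry.
transitivity (coefm (\prod_v letter_fps (w v) (later w v)) u).
  congr coefm; rewrite (partition_big w xpredT) //=; apply: eq_bigr => b _.
  rewrite -prod_letter_fps -uw -big_later.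
  by apply: eq_bigr => v /eqP->.
have /(agree_prod (index_enum 'I_n))/(_ u (msubset_refl u))-> :=
  fun (v : 'I_n) (_ : xpredT v) => letter_fps_agree v.
rewrite bigA_distr_bigA coefm_sum [RHS]big_mkcond /=; apply: eq_bigr => y _.
rewrite scaler_prod coefmZ mono_prod /=.
have -> : (u == seq_mset [seq ((y v).1 : nat) | v <- index_enum 'I_n & true]) = same_content w y.
  have sE (l : 'I_N) : seq_mset [seq ((y v).1 : nat) | v <- index_enum 'I_n & true] l =
      #|[set v | (y v).1 == l]|.
    rewrite mset_seqE filter_predT count_map cardsE cardE size_filter.
    by apply: eq_count => v.
  apply/eqP/forallP => [e l|e]; first by rewrite uw e sE.
  apply/msetP => l; case: (ltnP l N) => lN.
    by have /eqP := e (Ordinal lN); rewrite uw -sE.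
  have /mset_eq0P-> : l \notin u by apply/negP => /uN; rewrite ltnNge lN.
  rewrite mset_seqE; apply/esym/count_memPn/mapP => -[v _ e'].
  by rewrite e' leqNgt ltn_ord in lN.
case: (same_content w y); rewrite ?mulr1 ?mulr0 ?andbF // andbT.
rewrite /letter_weight big_split /= prodrXr -natr_prod.
have -> : (\prod_i good_letter w a i (y i) = good w a y :> nat)%N.
  rewrite /good; case: forallP => [gy|]; first by rewrite big1 // => v _; rewrite gy.
  move=> ngy; have [v nv] : exists v, ~~ good_letter w a v (y v).
    by apply/existsP; rewrite -negb_forall; apply/forallP.
  by rewrite (bigD1 v) //= (negbTE nv) mul0n.
case: (good w a y); last by rewrite mul0r.
by rewrite mul1r; congr (t ^+ _); rewrite -sum1dep_card [RHS]big_mkcond.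
Qed.

End CountWords.

Section Coefficients.
Variable R : numDomainType.
Implicit Type u : monomial.

Lemma sorted_geq_nth (ws : seq nat) i j : sorted geq ws -> (i <= j)%N ->
  (j < size ws)%N -> (nth 0%N ws j <= nth 0%N ws i)%N.
Proof.
move=> srt ij jn.
have tr : transitive geq by move=> y x z /= xy yz; apply: leq_trans yz xy.
by apply: (sorted_leq_nth tr leqnn 0%N srt) => //; rewrite inE (leq_ltn_trans ij).
Qed.

(** As [ws] is weakly decreasing, [F_word] only forbids elements of [Exd s] between equal
    neighbours; chaining neighbours covers all pairs in a block. *)
Lemma F_word_valid n N (w : 'I_n -> 'I_N) (ws : seq nat) (s : 'S_n) :
  size ws = n -> (forall v : 'I_n, nth 0%N ws v = w v) -> sorted geq ws ->
  F_word (Exd s) ws = valid w s.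
Proof.
move=> sz wsE srt; rewrite /F_word sz eqxx /=.
have anti (i j : 'I_n) : (i <= j)%N -> (w j <= w i)%N.
  move=> ij; rewrite -!wsE.
  by apply: sorted_geq_nth; rewrite // sz.
apply/forallP/validP => [H i j|vs i].
  have [m] := ubnP (j : nat); elim: m j => // m IH j jm ij e.
  have [j' j'1] : exists j' : 'I_n, j'.+1 = j.
    have pj : (j.-1 < n)%N by have := ltn_ord j; lia.
    by exists (Ordinal pj) => /=; lia.
  have wj' : w i = w j'.
    apply: val_inj; apply/eqP; rewrite eqn_leq [X in _ && X]anti; last by lia.
    by rewrite e anti //; lia.
  have stp : (barred s j' < barred s j)%N.
    have := H j'; rewrite j'1 ltn_ord => /andP[_ /implyP] /contra.
    rewrite -leqNgt !wsE -wj' e leqnn => /(_ isT); rewrite inE negb_exists => /forallP/(_ j).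
    rewrite j'1 eqxx /= -leqNgt leq_eqVlt => /orP[|//].
    (* No ties occur: barred codes are below n, unbarred ones are not, and s is injective. *)
    rewrite /barred; move=> eb; exfalso; move: eb.
    have ne : s j' != s j by rewrite (inj_eq perm_inj) -val_eqE /=; apply/eqP; lia.
    move: ne; rewrite -val_eqE /=; have := ltn_ord (s j'); have := ltn_ord (s j).
    by case: ifP => _; case: ifP => _; lia.
  have [ij'|j'i] := ltnP i j'; first by apply: ltn_trans stp; apply: IH => //; lia.
  by rewrite (_ : i = j') //; apply: val_inj => /=; lia.
apply/implyP => i1; pose j := Ordinal i1.
rewrite -[i.+1]/(j : nat) !wsE anti //=; apply/implyP; rewrite inE => /existsP[k /andP[/eqP k1 lt]].
have kj : k = j by apply: val_inj.
rewrite ltn_neqAle anti //= andbT; apply/eqP => /val_inj e.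
by have := vs i k; rewrite kj /= e ltnSn => /(_ isT erefl); rewrite ltnNge -kj (ltnW lt).
Qed.

(** Words counted by F are weakly decreasing, so only the sorted rearrangement of u can
    contribute. *)
Lemma coefm_F_fun n (S : {set 'I_n}) u :
  coefm (F_fun R S) u = ((size u == n) && F_word S (sort geq u))%:R.
Proof.
rewrite /=; congr (_%:R).
have uniq_word ws : ws \in permutations u -> F_word S ws -> ws = sort geq u.
  rewrite mem_permutations => pws /andP[/eqP sz /forallP H].
  apply: (@sorted_eq _ geq).
  - by move=> y x z /= xy yz; apply: leq_trans yz xy.
  - by move=> x y /= /andP[xy yx]; apply/eqP; rewrite eqn_leq xy yx.
  - apply/(sortedP 0%N) => i; rewrite sz => i1.
    by have := H (Ordinal (ltnW i1)); rewrite /= i1 /= => /andP[].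
  - by apply: sort_sorted => x y; apply: leq_total.
  by rewrite (perm_trans pws) // perm_sym perm_sort.
have pu : sort geq u \in permutations u by rewrite mem_permutations perm_sort.
case FS: (F_word S (sort geq u)); last first.
  rewrite andbF; apply/eqP; rewrite -leqn0 leqNgt -has_count; apply/hasPn => ws pws.
  by apply/negP => Fw; rewrite -(uniq_word ws) ?Fw // in FS.
have -> : (size u == n) by case/andP: FS; rewrite size_sort.
rewrite /= -(@eq_in_count _ (pred1 (sort geq u))).
  by rewrite count_uniq_mem ?permutations_uniq // pu.
by move=> ws pws /=; apply/eqP/idP => [->//|/(uniq_word _ pws)].
Qed.

(** The compatible permutations are grouped by the multiset [fc s] of letters at their fixed points;
    for each such divisor a, passing to words gives the polynomial [derange] of the rest of u. *)
Lemma coefm_Q_njk n j k u :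
  coefm (Q_njk R n j k) u = if size u == n then
    (\sum_(a <- divisors_mon u | size a == k) derange ('X : {poly R}) (u `\` a))`_j
  else 0.
Proof.
rewrite coefm_sum; under eq_bigr => s _ do rewrite coefm_F_fun.
case: eqP => [sz|_]; last by rewrite big1.
have uN := @mon_boundP u; set N := mon_bound u in uN.
pose ws := sort geq u.
have szw : size ws = n by rewrite size_sort.
have wsN i : (nth 0%N ws i < N)%N.
  have [lt|ge] := ltnP i (size ws); last by rewrite nth_default.
  by apply: uN; rewrite -(mem_sort geq) mem_nth.
pose w (v : 'I_n) : 'I_N := Ordinal (wsN v).
have srt : sorted geq ws by apply: sort_sorted => x y; apply: leq_total.
have w_anti (i i' : 'I_n) : (i <= i')%N -> (w i' <= w i)%N.
  by move=> ii; apply: sorted_geq_nth; rewrite // szw.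
have uw (l : 'I_N) : #|[set v | w v == l]| = u l.
  rewrite -count_mem_mset -(seq.permP (permEl (perm_sort geq u))) -/ws.
  rewrite -(mkseq_nth 0%N ws) /mkseq szw -val_enum_ord -map_comp count_map.
  by rewrite cardsE cardE enumT /enum_mem size_filter; apply: eq_count.
pose fc (s : 'S_n) : monomial := seq_mset [seq (w i : nat) | i <- enum 'I_n & s i == i].
have fcE s (l : 'I_N) : fc s l = #|[set i | (s i == i) && (w i == l)]|.
  rewrite mset_seqE count_map count_filter cardsE cardE enumT /enum_mem size_filter.
  by apply: eq_count => i; rewrite /= andbC.
have fc0 s l : (N <= l)%N -> fc s l = 0%N.
  move=> Nl; rewrite mset_seqE; apply/count_memPn/mapP => -[i _ e].
  by rewrite e leqNgt ltn_ord in Nl.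
have fcu s : fc s `<=` u.
  apply/msubsetP => l; case: (ltnP l N) => lN; last by rewrite fc0.
  rewrite (fcE s (Ordinal lN)) -(uw (Ordinal lN)); apply: subset_leq_card.
  by apply/subsetP => i; rewrite !inE => /andP[].
have fcP a s : a `<=` u -> (a == fc s) = fix_content w a s.
  move=> au; apply/eqP/forallP => [-> l|H]; first by rewrite fcE.
  apply/msetP => l; case: (ltnP l N) => lN.
    by have /eqP := H (Ordinal lN); rewrite -fcE.
  rewrite fc0 //; apply/eqP; rewrite mset_eq0; apply/negP => /(msubset_subset au)/uN.
  by rewrite ltnNge lN.
have sz_fc s : size (fc s) = fixpts s.
  rewrite (perm_size (perm_eq_seq_mset _)) size_map /fixpts cardsE cardE enumT.
  by rewrite /enum_mem.
transitivity (\sum_(s | valid w s && (fixpts s == k)) ('X^(exc s) : {poly R})`_j).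
  rewrite big_mkcond [RHS]big_mkcond; apply: eq_bigr => s _.
  rewrite /= (F_word_valid (w := w)) // coefXn [j == _]eq_sym.
  by case: (exc s == j); case: (valid w s); case: (fixpts s == k).
rewrite coef_sum; symmetry.
transitivity (\sum_(a <- divisors_mon u | size a == k)
    \sum_(s | valid w s && (a == fc s)) ('X^(exc s) : {poly R})`_j).
  rewrite big_seq_cond [RHS]big_seq_cond; apply: eq_bigr => a /andP[].
  rewrite mem_divisors_mon => au _; rewrite -coef_sum; apply: (congr1 (fun p : {poly R} => p`_j)).
  rewrite -(sum_words 'X uw uN au).
  rewrite -(sum_valid_word w_anti _ (fun m => 'X^m : {poly R})); last first.
    by move=> l; rewrite uw; move/msubsetP: au.
  by apply: eq_bigl => s; rewrite fcP.
rewrite (exchange_big_dep (fun s => valid w s && (fixpts s == k))) /=; last first.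
  by move=> a s /eqP <- /andP[-> /eqP ->]; rewrite sz_fc eqxx.
apply: eq_bigr => s /andP[vs /eqP fk].
rewrite -big_filter (_ : filter _ _ = [:: fc s]) ?big_seq1 //.
rewrite -(@filter_pred1_uniq _ (divisors_mon u)) ?divisors_mon_uniq ?mem_divisors_mon //.
apply: eq_filter => a; rewrite /= vs /=.
by case: (a =P fc s) => [->|]; rewrite ?andbF // sz_fc fk eqxx.
Qed.

End Coefficients.

(** * h-positivity, symmetry and unimodality *)

Section Relabelling.
Variables (s s' : nat -> nat).
Hypotheses (sK : cancel s s') (s'K : cancel s' s).
Implicit Types (a u : monomial).

Definition relabel u : monomial := seq_mset [seq s i | i <- u].

Lemma relabelE u x : relabel u x = u (s' x).
Proof.
rewrite mset_seqE count_map -count_mem_mset; apply: eq_count => i /=.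
by apply/eqP/eqP => [<-|->]; rewrite ?sK ?s'K.
Qed.

Lemma relabel_inj : injective relabel.
Proof. by move=> a b e; apply/msetP => x; rewrite -[x]sK -!relabelE e. Qed.

Lemma relabelB a u : relabel (u `\` a) = relabel u `\` relabel a.
Proof. by apply/msetP => x; rewrite relabelE !msetE2 !relabelE. Qed.

Lemma size_relabel u : size (relabel u) = size u.
Proof. by rewrite (perm_size (perm_eq_seq_mset _)) size_map. Qed.

Lemma relabel_sub a u : (relabel a `<=` relabel u) = (a `<=` u).
Proof.
by apply/msubsetP/msubsetP => H x; [rewrite -[x]sK -!relabelE | rewrite !relabelE].
Qed.

End Relabelling.

Lemma perm_divisors_relabel s s' u : cancel s s' -> cancel s' s ->
  perm_eq (divisors_mon (relabel s u)) [seq relabel s a | a <- divisors_mon u].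
Proof.
move=> sK s'K; apply: uniq_perm; rewrite ?divisors_mon_uniq //.
  by rewrite map_inj_uniq ?divisors_mon_uniq //; apply: relabel_inj sK s'K.
move=> a; rewrite mem_divisors_mon; apply/idP/mapP => [au|[b + ->]]; last first.
  by rewrite mem_divisors_mon (relabel_sub sK s'K).
have e : relabel s (relabel s' a) = a.
  by apply/msetP => x; rewrite (relabelE sK s'K) (relabelE s'K sK) s'K.
by exists (relabel s' a); rewrite // mem_divisors_mon -(relabel_sub sK s'K) e.
Qed.

Section HPositive.
Variable R : numDomainType.
Implicit Types (f g : fps R) (u : monomial).

Lemma symmetric_hsym m : symmetric_function (hsym R m).
Proof.
split=> [|s [s' sK s'K] u]; last by rewrite /= -/(relabel s u) size_relabel.
by exists m => u /=; case: (size u =P m) => [->|_]; rewrite ?eqxx.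
Qed.

Lemma symmetric0 : symmetric_function (0 : fps R).
Proof. by split=> //; exists 0%N => u; rewrite coefm0 eqxx. Qed.

Lemma symmetric1 : symmetric_function (1 : fps R).
Proof.
split=> [|s [s' sK s'K] u].
  by exists 0%N => u; rewrite coefm1; case: (u =P mset0) => [->|_]; rewrite ?size_mset0 ?eqxx.
by rewrite !coefm1 -!size_mset_eq0 -/(relabel s u) size_relabel.
Qed.

Lemma symmetricD f g :
  symmetric_function f -> symmetric_function g -> symmetric_function (f + g).
Proof.
move=> [[d fd] fs] [[e ge] gs]; split; last first.
  by move=> s bs u; rewrite !coefmD fs ?gs.
exists (maxn d e) => u; rewrite coefmD leq_max.
have [->|/fd-> //] := eqVneq (coefm f u) 0.
by rewrite add0r => /ge->; rewrite orbT.
Qed.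

Lemma symmetricZ c f : symmetric_function f -> symmetric_function (c *: f).
Proof.
move=> [[d fd] fs]; split; last by move=> s bs u; rewrite !coefmZ fs.
by exists d => u; rewrite coefmZ => /eqP cf; apply/fd/eqP => e; apply: cf; rewrite e mulr0.
Qed.

Lemma symmetricM f g :
  symmetric_function f -> symmetric_function g -> symmetric_function (f * g).
Proof.
move=> [[d fd] fs] [[e ge] gs]; split; last first.
  move=> s bs u; have [s' sK s'K] := bs; rewrite -/(relabel s u).
  rewrite !coefmM_div (perm_big _ (perm_divisors_relabel u sK s'K)) big_map.
  by apply: eq_bigr => a _; rewrite -(relabelB sK s'K) fs ?gs.
exists (d + e)%N => u; apply: contraNT; rewrite -ltnNge => lt.
rewrite coefmM_div big_seq big1 // => a; rewrite mem_divisors_mon => au.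
have [->|/fd da] := eqVneq (coefm f a) 0; first by rewrite mul0r.
have [->|/ge] := eqVneq (coefm g (u `\` a)) 0; first by rewrite mulr0.
by rewrite size_msetB //; have := size_msub au; lia.
Qed.

Lemma h_positive_symmetric f : h_positive f -> symmetric_function f.
Proof.
case=> L [c [_ ->]]; apply: (big_ind (@symmetric_function R)) => [||la _].
- exact: symmetric0.
- exact: symmetricD.
apply: symmetricZ; apply: (big_ind (@symmetric_function R)) => [||m _].
- exact: symmetric1.
- exact: symmetricM.
exact: symmetric_hsym.
Qed.

(** Lists of pairs may repeat a partition with different coefficients, so addition is concatenation;
    collecting equal partitions returns to the definition. *)
Lemma h_positiveP f : h_positive f <->
  exists l : seq (seq nat * R),
    all (fun p => is_partition p.1 && (0 <= p.2)) l /\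
    f = \sum_(p <- l) p.2 *: hsym_part R p.1.
Proof.
split=> [[L [c [Lc ->]]]|[l [lP ->]]].
  exists [seq (la, c la) | la <- L]; rewrite big_map; split=> //.
  by apply/allP => _ /mapP[la laL ->]; apply: Lc.
exists (undup [seq p.1 | p <- l]), (fun la => \sum_(p <- l | p.1 == la) p.2); split.
  move=> la; rewrite mem_undup => /mapP[p pl ->].
  have /andP[-> _] := allP lP p pl; rewrite big_seq_cond sumr_ge0 // => q /andP[ql _].
  by have /andP[_ ->] := allP lP q ql.
under [RHS]eq_bigr => la _ do rewrite scaler_suml.
rewrite (exchange_big_dep xpredT) //=; apply: eq_big_seq => p pl.
rewrite (eq_bigl (pred1 p.1)) => [|la]; last by rewrite /= eq_sym.
by rewrite -big_filter filter_pred1_uniq ?undup_uniq ?mem_undup ?map_f // big_seq1.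
Qed.

Lemma h_positive0 : h_positive (0 : fps R).
Proof. by apply/h_positiveP; exists [::]; rewrite big_nil. Qed.

Lemma h_positive1 : h_positive (1 : fps R).
Proof.
apply/h_positiveP; exists [:: ([::], 1)].
by rewrite big_seq1 /hsym_part big_nil scale1r /= ler01.
Qed.

Lemma h_positiveD f g : h_positive f -> h_positive g -> h_positive (f + g).
Proof.
move=> /h_positiveP[l [lP ->]] /h_positiveP[l' [lP' ->]]; apply/h_positiveP.
by exists (l ++ l'); rewrite all_cat lP lP' big_cat.
Qed.

Lemma h_positive_sum (I : Type) (r : seq I) (P : pred I) (F : I -> fps R) :
  (forall i, P i -> h_positive (F i)) -> h_positive (\sum_(i <- r | P i) F i).
Proof. by move=> FP; apply: big_ind => //; [exact: h_positive0 | exact: h_positiveD]. Qed.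

Lemma hsym0 : hsym R 0 = 1.
Proof. by apply: fpsP => u; rewrite coefm1 /= size_mset_eq0. Qed.

Lemma h_positive_hsymM m f : h_positive f -> h_positive (hsym R m * f).
Proof.
(* A part 0 may not be inserted into a partition, but h_0 = 1. *)
have [->|m0] := posnP m; first by rewrite hsym0 mul1r.
case/h_positiveP=> l [lP ->]; apply/h_positiveP.
exists [seq (sort geq (m :: p.1), p.2) | p <- l]; split.
  rewrite all_map; apply: sub_all lP => p /= /andP[/andP[_ n0] ->]; rewrite andbT.
  rewrite /is_partition mem_sort inE negb_or n0 eq_sym -lt0n m0 !andbT.
  by apply: sort_sorted => x y; apply: leq_total.
rewrite big_map mulr_sumr; apply: eq_bigr => p _ /=.
rewrite -scalerAr; congr (_ *: _).
by rewrite /hsym_part (perm_big _ (permEl (perm_sort _ _))) big_cons.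
Qed.

Lemma coefm_hsymM m f u :
  coefm (hsym R m * f) u =
  \sum_(a <- divisors_mon u | size a == m) coefm f (u `\` a).
Proof.
rewrite coefmM_div [RHS]big_mkcond; apply: eq_bigr => a _ /=.
by case: (size a == m); rewrite ?mul1r ?mul0r.
Qed.

Lemma h_le_refl f : h_le f f.
Proof. by rewrite /h_le subrr; exact: h_positive0. Qed.

Lemma h_le_trans f g h : h_le f g -> h_le g h -> h_le f h.
Proof. by move=> fg gh; rewrite /h_le -(subrKA g); apply: h_positiveD. Qed.

End HPositive.

(** * Symmetric unimodal families indexed by the integers *)

Section SymmetricUnimodalFamilies.
Variable R : numDomainType.
Implicit Types (c z : int) (f g : int -> fps R).

(* The coefficients of a polynomial, extended by zero to all integer exponents,
   are h-positive, symmetric about c/2 and increasing up to c/2. *)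
Definition sym_unimodal c f : Prop :=
  [/\ forall z, (z < 0) -> f z = 0,
      forall z, f z = f (c - z) &
      forall z, (2 * z + 1 <= c) -> h_le (f z) (f (z + 1))].

(** The hypotheses say that z is no farther from c/2 than z', which is on the lower side. Reflect z
    into the lower half and climb in unit steps. *)
Lemma sym_unimodal_le c f z z' : sym_unimodal c f ->
  (z' <= z) -> (z + z' <= c) -> h_le (f z') (f z).
Proof.
case=> _ fs fi; wlog zc : z / (2 * z <= c) => [H|] z'z zz'.
  have [|gt] := lerP (2 * z) c; first by move=> le; apply: H.
  by rewrite (fs z); apply: H; lia.
have [m em] : exists m : nat, z = z' + m%:Z by exists `|(z - z')%R|%N; lia.
rewrite {z}em in z'z zz' zc *; elim: m zc {z'z zz'} => [|m IH] zc.
  by rewrite addr0; exact: h_le_refl.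
by rewrite -addn1 PoszD addrA; apply: (h_le_trans (IH _) (fi _ _)); lia.
Qed.

Lemma sym_unimodal_pos c f z : sym_unimodal c f -> h_positive (f z).
Proof.
move=> fU; have [f0 _ _] := fU.
(* This index is negative, so f vanishes there, and far enough from c/2 for the comparison with
   z. *)
have := @sym_unimodal_le c f z (- (1 + `|z| + `|c|)) fU.
by rewrite /h_le [f (- _)]f0 ?subr0; [apply; lia | lia].
Qed.

Lemma eq_sym_unimodal c f g : f =1 g -> sym_unimodal c f -> sym_unimodal c g.
Proof. by move/funext->. Qed.

Lemma sym_unimodal0 c : sym_unimodal c (fun=> 0).
Proof. by split=> // z _; exact: h_le_refl. Qed.

Lemma sym_unimodalD c f g :
  sym_unimodal c f -> sym_unimodal c g -> sym_unimodal c (fun z => f z + g z).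
Proof.
move=> [f0 fs fi] [g0 gs gi]; split=> z.
- by move=> z0; rewrite f0 ?g0 ?addr0.
- by rewrite fs gs.
by move=> zc; rewrite /h_le opprD addrACA; apply: h_positiveD; [apply: fi | apply: gi].
Qed.

Lemma sym_unimodal_sum c m (F : nat -> int -> fps R) :
  (forall i, (i < m)%N -> sym_unimodal c (F i)) ->
  sym_unimodal c (fun z => \sum_(i < m) F i z).
Proof.
elim: m => [|m IH] FU.
  by apply: eq_sym_unimodal (sym_unimodal0 c) => z; rewrite big_ord0.
apply: eq_sym_unimodal (sym_unimodalD (IH _) (FU m _)) => [z||]; last by [].
  by rewrite big_ord_recr.
by move=> i im; apply: FU; apply: ltnW.
Qed.

Lemma sym_unimodal_hsymM c m f :
  sym_unimodal c f -> sym_unimodal c (fun z => hsym R m * f z).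
Proof.
move=> [f0 fs fi]; split=> z.
- by move=> z0; rewrite f0 ?mulr0.
- by rewrite fs.
by move=> zc; rewrite /h_le -mulrBr; apply: h_positive_hsymM; apply: fi.
Qed.

Lemma sym_unimodal_shift c f :
  sym_unimodal c f -> sym_unimodal (c + 2) (fun z => f (z - 1)).
Proof.
move=> fU; have [f0 fs fi] := fU; split=> z.
- by move=> z0; apply: f0; lia.
- by rewrite fs; congr f; lia.
by move=> zc; apply: (sym_unimodal_le fU); lia.
Qed.

(* Multiplication by 1 + t + ... + t^(m-1). *)
Lemma sym_unimodal_geom c m f : sym_unimodal c f ->
  sym_unimodal (c + m%:Z - 1) (fun z => \sum_(i < m) f (z - i%:Z)).
Proof.
move=> fU; have [f0 fs fi] := fU; split=> z.
- by move=> z0; rewrite big1 // => i _; apply: f0; lia.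
- rewrite [RHS](reindex_inj rev_ord_inj); apply: eq_bigr => i _ /=.
  by rewrite fs; congr f; have := ltn_ord i; lia.
move=> zc; case: m zc => [|m] zc; first by rewrite !big_ord0; exact: h_le_refl.
(* The two windows overlap except for f (z - m) and f (z + 1), which compare because (z - m) + (z +
   1) <= c. *)
rewrite [in X in h_le X _]big_ord_recr [in X in h_le _ X]big_ord_recl /=.
have -> : \sum_(i < m) f (z + 1 - (bump 0 i)%:Z) = \sum_(i < m) f (z - i%:Z).
  by apply: eq_bigr => i _; congr f; rewrite /bump; lia.
rewrite /h_le addrKA.
by apply: (sym_unimodal_le fU); lia.
Qed.

Section Polynomial.
Variables (c : int) (f : int -> fps R) (P : {poly fps R}).
Hypotheses (fU : sym_unimodal c f) (P0 : P != 0).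
Hypothesis PE : forall j : nat, P`_j = f j.

Let low_neq0 : P`_(low_deg P) != 0.
Proof.
apply: (@nth_find _ 0 (predC1 0)); apply/hasP; exists (lead_coef P).
  by rewrite lead_coefE mem_nth // prednK // lt0n size_poly_eq0.
by rewrite /= lead_coef_eq0.
Qed.

Let high_neq0 : P`_(high_deg P) != 0.
Proof. by rewrite -lead_coefE lead_coef_eq0. Qed.

Let low_le j : P`_j != 0 -> (low_deg P <= j)%N.
Proof.
apply: contraNT; rewrite -ltnNge => jl; apply/eqP.
by have /negbT := before_find 0 jl; rewrite /= negbK => /eqP.
Qed.

Let high_ge j : P`_j != 0 -> (j <= high_deg P)%N.
Proof.
apply: contraNT; rewrite -ltnNge => jl; rewrite nth_default //.
by move: jl; rewrite /high_deg; case: (size P).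
Qed.

(** Reflection in c/2 preserves nonvanishing, so c - low <= high and low <= c - high. *)
Let low_high : c = (low_deg P + high_deg P)%N.
Proof.
have [f0 fs _] := fU.
have refl j : P`_j != 0 -> exists2 j' : nat, c - j%:Z = j' & P`_j' != 0.
  rewrite PE fs => nz; have cj : (0 <= c - j%:Z)%R.
    by rewrite leNgt; apply: contraNN nz => /f0->.
  by exists `|(c - j%:Z)%R|%N; rewrite ?PE ?gez0_abs.
have [j ej /high_ge jh] := refl _ low_neq0.
have [i ei /low_le il] := refl _ high_neq0.
lia.
Qed.

Lemma sym_unimodal_poly :
  [/\ t_symmetric P, t_unimodal (@h_le R) P & center_of_symmetry P = c%:~R / 2%:R].
Proof.
have [f0 fs fi] := fU; have lh := low_le high_neq0.
split.
- split=> // i il; rewrite !PE fs; congr f; lia.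
- split=> //.
  + by move=> i il; rewrite !PE -addn1 PoszD; apply: fi; lia.
  + by rewrite !PE fs; congr f; lia.
  move=> i il; rewrite !PE -addn1 PoszD (fs (i%:Z + 1)) (fs i).
  (* Above the center both exponents have been reflected, so this is an ascending step from c - (i +
     1). *)
  by rewrite [X in h_le _ (f X)](_ : _ = c - (i%:Z + 1) + 1); [apply: fi; lia | lia].
by rewrite /center_of_symmetry low_high pmulrn.
Qed.

End Polynomial.
End SymmetricUnimodalFamilies.

(** * The recurrence and the theorem *)

Section Eulerian.
Variable R : numDomainType.
Implicit Types (u : monomial) (z : int).

Definition coefz (p : {poly R}) z : R := if z is Posz j then p`_j else 0.

Lemma coefz_sum (I : Type) (r : seq I) (P : pred I) (F : I -> {poly R}) z :
  coefz (\sum_(i <- r | P i) F i) z = \sum_(i <- r | P i) coefz (F i) z.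
Proof. by case: z => j; rewrite /coefz ?coef_sum // big1. Qed.

Lemma coefz_XnM i (p : {poly R}) z : coefz ('X^i * p) z = coefz p (z - i%:Z).
Proof.
case: z => j /=; last by rewrite /coefz; case E: (Negz j - i%:Z) => //; lia.
rewrite coefXnM; case: ltnP => ij; last by rewrite subzn.
by rewrite /coefz; case E: (j%:Z - i%:Z) => //; lia.
Qed.

(* Q_{n,z,0}, with z ranging over all integers *)
Definition derange_fps (n : nat) z : fps R :=
  Fps (fun u => if size u == n then coefz (derange 'X u) z else 0).

Lemma coefm_hsymM_derange n m z u :
  coefm (hsym R m * derange_fps n z) u = if size u == (m + n)%N
    then coefz (\sum_(a <- divisors_mon u | size a == m) derange 'X (u `\` a)) z
    else 0.
Proof.
rewrite coefm_hsymM coefz_sum big_seq_cond [in RHS]big_seq_cond.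
have sz a : (a \in divisors_mon u) && (size (a : monomial) == m) ->
    (size (u `\` a) == n) = (size u == (m + n)%N).
  rewrite mem_divisors_mon => /andP[au /eqP <-]; rewrite size_msetB //.
  by have := size_msub au; lia.
case: ifP => un; first by apply: eq_bigr => a /sz; rewrite /= un => ->.
by rewrite big1 // => a /sz; rewrite /= un => ->.
Qed.

Lemma derange_fps0 z : derange_fps 0 z = (z == 0)%:R.
Proof.
apply: fpsP => u; have -> : coefm ((z == 0)%:R : fps R) u = ((z == 0) && (u == mset0))%:R.
  by case: (z == 0); rewrite ?coefm0.
rewrite /= size_mset_eq0; case: eqP => [->|_]; last by rewrite andbF.
by rewrite derange0 andbT; case: z => [[|j]|j]; rewrite /= ?coef1.
Qed.

(** The degree n part of the recurrence for Q, read off from [derange_rec]; the index is shifted, so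
    h_{m+1} comes with t [m]_t. *)
Lemma derange_fpsS n z : (0 < n)%N -> derange_fps n z =
  \sum_(m < n) hsym R m.+1 * \sum_(i < m) derange_fps (n - m.+1) (z - 1 - i%:Z).
Proof.
move=> n0; apply: fpsP => u; rewrite coefm_sum.
have coefz_XM p y : coefz ('X * p) y = coefz p (y - 1) := coefz_XnM 1 p y.
under eq_bigr => m _ do (rewrite mulr_sumr coefm_sum;
  under eq_bigr => i _ do rewrite coefm_hsymM_derange subnKC ?ltn_ord //).
rewrite [LHS]/=; case: eqP => [un|_]; last by rewrite big1 // => m _; rewrite big1.
rewrite derange_rec -?size_mset_eq0 ?un -?lt0n // coefz_sum.
apply: eq_bigr => m _; rewrite -mulrA mulr_suml mulr_sumr coefz_sum.
by apply: eq_bigr => i _; rewrite coefz_XM coefz_XnM.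
Qed.

(** Strong induction: in the summand with h_{i+1} the remaining degree n - i - 1, the factor [i]_t
    and the factor t add n - i - 1, i - 1 and 2 to twice the center, in total n. *)
Lemma derange_fps_unimodal n : sym_unimodal n%:Z (derange_fps n).
Proof.
have [m] := ubnP n; elim: m n => // m IH [|n] nm.
  split=> z; rewrite ?derange_fps0; first by case: eqP => // ->.
    by rewrite sub0r oppr_eq0.
  move=> z0; rewrite /h_le; have -> : (z == 0) = false by apply/eqP; lia.
  by rewrite subr0; case: eqP => _; [exact: h_positive1 | exact: h_positive0].
apply: eq_sym_unimodal (fun z => esym (derange_fpsS z (ltn0Sn n))) _.
apply: (@sym_unimodal_sum R _ _ (fun i z => hsym R i.+1 *
  \sum_(j < i) derange_fps (n.+1 - i.+1) (z - 1 - j%:Z))) => i ni.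
apply: (@sym_unimodal_hsymM R _ _ (fun z => \sum_(j < i) derange_fps (n.+1 - i.+1) (z - 1 - j%:Z))).
have -> : n.+1%:Z = (n.+1 - i.+1)%N%:Z + i%:Z - 1 + 2 by lia.
apply: (@sym_unimodal_shift R _ (fun z => \sum_(j < i) derange_fps (n.+1 - i.+1) (z - j%:Z))).
by apply: sym_unimodal_geom; apply: IH; lia.
Qed.

(** The k fixed points may carry any multiset of k letters, which is the factor h_k. *)
Lemma Q_njkE n j k :
  Q_njk R n j k = if (k <= n)%N then hsym R k * derange_fps (n - k) j else 0.
Proof.
apply: fpsP => u; rewrite coefm_Q_njk; have [kn|nk] := leqP k n.
  by rewrite coefm_hsymM_derange subnKC.
case: eqP => // un; rewrite big_seq_cond big1 ?coef0 // => a /andP[].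
rewrite mem_divisors_mon => /size_msub; rewrite un => an /eqP e.
by rewrite e leqNgt nk in an.
Qed.

(* The coefficients of sum_j Q_{n,j} t^j, in the form that shows its center. *)
Definition eulerian_fps (n : nat) z : fps R :=
  \sum_(m < n) hsym R m.+1 * \sum_(i < m.+1) derange_fps (n - m.+1) (z - i%:Z).

(** The term k = 0 is expanded by the recurrence and matched with the terms k = m + 1, using t [m]_t
    + 1 = [m+1]_t. *)
Lemma Q_njE n j : (0 < n)%N -> Q_nj R n j = eulerian_fps n j.
Proof.
move=> n0; rewrite /Q_nj big_ord_recl Q_njkE subn0 hsym0 mul1r derange_fpsS //.
rewrite -big_split /=; apply: eq_bigr => m _.
rewrite Q_njkE /bump /= add1n ltn_ord big_ord_recl /= subr0 mulrDr addrC.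
congr (_ + _ * _).
by apply: eq_bigr => i _; congr derange_fps; rewrite /bump; lia.
Qed.

Lemma eulerian_fps_unimodal n : sym_unimodal (n%:Z - 1) (eulerian_fps n).
Proof.
apply: (@sym_unimodal_sum R _ _ (fun m z => hsym R m.+1 *
  \sum_(i < m.+1) derange_fps (n - m.+1) (z - i%:Z))) => m mn.
apply: (@sym_unimodal_hsymM R _ _ (fun z => \sum_(i < m.+1) derange_fps (n - m.+1) (z - i%:Z))).
have -> : n%:Z - 1 = (n - m.+1)%N%:Z + m.+1%:Z - 1 by lia.
exact/sym_unimodal_geom/derange_fps_unimodal.
Qed.

(** The factor t in the recurrence kills the constant term; by symmetry the coefficient of t^n
    vanishes too, which the sum over j < n requires. *)
Lemma derange_fps_const n : (0 < n)%N -> derange_fps n 0 = 0.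
Proof.
move=> n0; rewrite derange_fpsS // big1 // => m _; rewrite big1 ?mulr0 // => i _.
by have [-> //] := derange_fps_unimodal (n - m.+1); lia.
Qed.

Lemma eulerian_fps_const n : (0 < n)%N -> eulerian_fps n 0 = hsym R n.
Proof.
case: n => // n _; rewrite /eulerian_fps big_ord_recr /= subnn big1 => [|m _].
  rewrite add0r big_ord_recl /= derange_fps0 subr0 eqxx big1 ?addr0 ?mulr1 // => i _.
  by rewrite derange_fps0 /bump; case: eqP => //; lia.
rewrite big1 ?mulr0 // => i _; have := ltn_ord m.
have [d0 _ _] := derange_fps_unimodal (n.+1 - m.+1).
case: (i : nat) => [|j] mn; last by apply: d0; lia.
by rewrite subr0 derange_fps_const // subSS subn_gt0.
Qed.

Lemma hsym_neq0 n : hsym R n != 0.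
Proof.
apply/eqP => /(congr1 (fun f => coefm f (msetn n 0%N))) /eqP.
by rewrite coefm0 /= enum_msetn size_nseq eqxx oner_eq0.
Qed.

Lemma Q_njk_h_positive n j k : h_positive (Q_njk R n j k).
Proof.
rewrite Q_njkE; case: ifP => _; last exact: h_positive0.
exact/h_positive_hsymM/(sym_unimodal_pos _ (derange_fps_unimodal _)).
Qed.

Lemma Q_nj_h_positive n j : h_positive (Q_nj R n j).
Proof. by apply: h_positive_sum => k _; apply: Q_njk_h_positive. Qed.

End Eulerian.

Unset Implicit Arguments.

Theorem theorem5p1 (R : numDomainType) :
  (forall n j k : nat,
     (symmetric_function (Q_njk R n j k) /\ h_positive (Q_njk R n j k)) /\
     (symmetric_function (Q_nj R n j) /\ h_positive (Q_nj R n j))) /\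
  (forall n k : nat,
     let P : {poly fps R} := \sum_(j < n) Q_njk R n j k *: 'X^j in
     P != 0 ->
     [/\ t_symmetric P,
         t_unimodal (@h_le R) P &
         center_of_symmetry P = (n%:R - k%:R) / 2%:R]) /\
  (forall n : nat, (0 < n)%N ->
     let P : {poly fps R} := \sum_(j < n) Q_nj R n j *: 'X^j in
     [/\ t_symmetric P,
         t_unimodal (@h_le R) P &
         center_of_symmetry P = (n%:R - 1) / 2%:R]).
Proof.
split; [|split].
- move=> n j k; have Qp := Q_njk_h_positive R n j k; have Q'p := Q_nj_h_positive R n j.
  by split; split=> //; apply: h_positive_symmetric.
- move=> n k P P0; have PE j : P`_j = if (j < n)%N then Q_njk R n j k else 0.
    by rewrite /P -(poly_def n (fun j => Q_njk R n j k)) coef_poly.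
  have [kn|nk] := leqP k n; last first.
    case/eqP: P0; apply/polyP => j; rewrite PE Q_njkE (leqNgt k) nk coef0.
    by case: ifP.
  have n0 : (0 < n)%N.
    by rewrite lt0n; apply: contraNneq P0 => n0; rewrite /P n0 big_ord0.
  have fU := sym_unimodal_hsymM k (derange_fps_unimodal R (n - k)).
  have PE' (j : nat) : P`_j = hsym R k * derange_fps R (n - k) j.
    (* For j >= n the reflected exponent n - k - j is negative, except when k = 0 and j = n, where
       it is 0. *)
    rewrite PE Q_njkE kn; case: ltnP => // nj.
    have [f0 fs _] := derange_fps_unimodal R (n - k); rewrite fs.
    have [k0|k0] := posnP k; last by rewrite f0 ?mulr0 //; lia.
    have [->|ne] := eqVneq j n; last by rewrite f0 ?mulr0 //; lia.
    by rewrite k0 subn0 subrr derange_fps_const ?mulr0.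
  by rewrite -natrB // pmulrn; apply: sym_unimodal_poly fU P0 PE'.
move=> n n0 P; have fU := eulerian_fps_unimodal R n.
have PE (j : nat) : P`_j = eulerian_fps R n j.
  rewrite /P -(poly_def n (fun j => Q_nj R n j)) coef_poly; case: ltnP => nj.
    by rewrite Q_njE.
  by have [f0 fs _] := fU; rewrite fs f0 //; lia.
have P0 : P != 0.
  (* The constant coefficient of P is h_n. *)
  apply/eqP => P0; have /eqP := hsym_neq0 R n; apply.
  by rewrite -(eulerian_fps_const R n0) -(PE 0%N) P0 coef0.
have -> : (n%:R - 1 : rat) = (n%:Z - 1)%:~R by rewrite intrB -pmulrn.
exact: sym_unimodal_poly fU P0 PE.
Qed.
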